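(* Let $\varrho\in(0,1]$, $r\ge2$, $q\in(r,+\infty)$, $s\ge0$, $L\ge0$, $T>0$. Then $$e^{(r)}_n(F^{\varrho,r,q}_L,\mathcal{W}_s,\delta_1,\delta_2)=\Omega\bigl(\max\{n^{-\varrho},\delta_1\}\bigr),$$ as $n\to+\infty$ and $\max\{\delta_1,\delta_2\}\to0+$.
   Context: $W=\{W(t)\}_{t\ge0}$ is a standard one-dimensional Wiener process on a complete probability space $(\Omega,\Sigma,\mathbb{P})$ with respect to a filtration $\{\Sigma_t\}_{t\ge0}$ satisfying the usual conditions. For a real random variable $Y$, $\|Y\|_q=(\mathbb{E}|Y|^q)^{1/q}$. $\mathcal{I}(X,W)=\int_0^T X(t)\,dW(t)$ is the It\^o integral. Integrands: for $L\ge0$, $F^{\varrho,r,q}_L$ is the class of all $\{\Sigma_t\}$-progressively measurable processes $X:[0,T]\times\Omega\to\mathbb{R}$ such that $\bigl\|\sup_{t\in[0,T]}|X(t)|\bigr\|_q\le L$ and $\|X(t)-X(z)\|_r\le L|t-z|^{\varrho}$ for all $t,z\in[0,T]$. Disturbing functions $p:[0,T]\times\mathbb{R}\to\mathbb{R}$ (with the convention $|y|^s:=0$ for all $y$ if $s=0$): $\mathcal{K}^1$ is the set of Borel measurable $p$ with $|p(t,y)|\le 1+|y|$ for all $t,y$; $\mathcal{K}^2_s$ is the set of $p\in C^{1,2}([0,T]\times\mathbb{R})$ with $\max\{|\partial_t p(t,y)|,|\partial_y p(t,y)|,|\partial_y^2 p(t,y)|\}\le 1+|y|^s$ for all $t,y$.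 Noisy versions, for $\delta_1,\delta_2\ge0$: $V_X(\delta_1)$ is the set of processes $\tilde X(t,\omega)=X(t,\omega)+\delta_1 p_X(t,X(t,\omega))$ with $p_X\in\mathcal{K}^1$; $\mathcal{W}_s(\delta_2)$ is the set of processes $\tilde W(t,\omega)=W(t,\omega)+\delta_2 p_W(t,W(t,\omega))$ with $p_W\in\mathcal{K}^2_s$ (identities for all $(t,\omega)\in[0,T]\times\Omega$). Algorithms: an algorithm $\mathcal{A}$ is given by $\mathcal{A}(\tilde X,\tilde W,\delta_1,\delta_2)=\varphi(\tilde X(t_0),\dots,\tilde X(t_{i_1-1}),\tilde W(z_0),\dots,\tilde W(z_{i_2-1}))$, where $i_1,i_2\in\mathbb{N}=\{1,2,\dots\}$, the $t_j\in[0,T]$ are fixed pairwise distinct points, the $z_j\in[0,T]$ are fixed pairwise distinct points (nonadaptive information), and $\varphi:\mathbb{R}^{i_1+i_2}\to\mathbb{R}$ is Borel measurable. $\Phi_n$ is the class of all such algorithms with total number of evaluations $i_1+i_2\le n$. Errors: $$e^{(r)}(\mathcal{A},F^{\varrho,r,q}_L,\mathcal{W}_s,\delta_1,\delta_2)=\sup_{X\in F^{\varrho,r,q}_L}\ \sup_{(\tilde X,\tilde W)\in V_X(\delta_1)\times\mathcal{W}_s(\delta_2)}\|\mathcal{I}(X,W)-\mathcal{A}(\tilde X,\tilde W,\delta_1,\delta_2)\|_r,$$ and the $n$th minimal error is $e^{(r)}_n(F^{\varrho,r,q}_L,\mathcal{W}_s,\delta_1,\delta_2)=\inf_{\mathcal{A}\in\Phi_n}e^{(r)}(\mathcal{A},F^{\varrho,r,q}_L,\mathcal{W}_s,\delta_1,\delta_2)$.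 Asymptotic notation: $\Omega$ ''as $n\to+\infty$ and $\max\{\delta_1,\delta_2\}\to0+$'' means that there are constants $c,n_0,\delta_0>0$, depending only on $r,q,L,\varrho,T,s$, such that the lower bound with constant $c$ holds for all $n\ge n_0$ and all $\delta_1,\delta_2\in[0,\delta_0]$.
   Formalization: The formal theorem assumes L > 0 instead of L ≥ 0; for L = 0 every integrand vanishes almost surely, so the zero algorithm has error 0 and the claimed lower bound fails. *)

(* Defs.v *)
(* MathComp / MathComp-Analysis. *)
From HB Require Import structures.
From mathcomp Require Import all_boot all_order all_algebra.
From mathcomp Require Import all_classical all_reals all_analysis.

Set Implicit Arguments.
Unset Strict Implicit.
Unset Printing Implicit Defensive.

Import Order.TTheory GRing.Theory Num.Theory.
Import numFieldNormedType.Exports.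

Local Open Scope classical_set_scope.
Local Open Scope ring_scope.

Section FilteredSpace.
Context {R : realType} {d : measure_display} {Omega : measurableType d}.
Variables (P : probability Omega R) (F : R -> set (set Omega)).

(* Time-indexed objects are total functions of a real time; only the values at
   times t >= 0 (at times t in [0, T] for integrands) are ever constrained or
   used. *)

Definition usual_conditions : Prop :=
  [/\ measure_is_complete P,
      forall t : R, 0 <= t -> sigma_algebra setT (F t) /\ F t `<=` measurable,
      forall t u : R, 0 <= t -> t <= u -> F t `<=` F u,
      forall t : R, 0 <= t -> \bigcap_(u in [set u | t < u]) F u = F t
    & forall A, P.-negligible A -> F 0 A].

(* [g_sigma_algebraType (F t)] is Omega equipped with the sigma-algebra F t. *)
Definition F_measurable (t : R) (Y : Omega -> R) : Prop :=
  measurable_fun [set: g_sigma_algebraType (F t)] Y.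

Definition is_wiener (W : R -> Omega -> R) : Prop :=
  [/\ forall t : R, 0 <= t -> F_measurable t (W t),
      {ae P, forall w, W 0 w = 0},
      {ae P, forall w, {within `[0, +oo[, continuous (fun t => W t w)}},
      forall t u : R, 0 <= t -> t < u ->
        forall (A : set Omega) (B : set R), F t A -> measurable B ->
          P (A `&` [set w | B (W u w - W t w)])
          = (P A * P [set w | B (W u w - W t w)%R])%E
    & (* the second parameter of [normal_prob] is the standard deviation *)
      forall t u : R, 0 <= t -> t < u -> forall B : set R, measurable B ->
        P [set w | B (W u w - W t w)]
        = normal_prob 0 (Num.sqrt (u - t)) B].

Variable T : R.

(* [0, t] x Omega is a measurable rectangle, so measurability on it for the
   product of the Borel sigma-algebra of R with F t is measurability for
   B([0, t]) (x) F t. *)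
Definition progressively_measurable (X : R -> Omega -> R) : Prop :=
  forall t : R, 0 <= t <= T ->
    measurable_fun (`[0, t] `*` [set: g_sigma_algebraType (F t)])
      (fun z : R * g_sigma_algebraType (F t) => X z.1 z.2).

(* A simple process is \sum_(i < k) xi_i 1_(t_i, t_(i+1)] with
   0 = t_0 < ... < t_k = T and xi_i bounded and F_(t_i)-measurable. *)
Record simple_process := SimpleProcess {
  sp_size : nat;
  sp_time : nat -> R;
  sp_coef : nat -> Omega -> R;
  sp_time0 : sp_time 0%N = 0;
  sp_timeT : sp_time sp_size = T;
  sp_time_lt : forall i, (i < sp_size)%N -> sp_time i < sp_time i.+1;
  sp_coef_meas : forall i, (i < sp_size)%N ->
    F_measurable (sp_time i) (sp_coef i);
  sp_coef_bounded : exists M : R, forall i, (i < sp_size)%N ->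
    forall w, `|sp_coef i w| <= M }.

Definition sp_val (H : simple_process) (t : R) (w : Omega) : R :=
  \sum_(i < sp_size H)
    sp_coef H i w * \1_(`]sp_time H i, sp_time H i.+1]%classic) t.

Definition sp_integral (W : R -> Omega -> R) (H : simple_process)
    (w : Omega) : R :=
  \sum_(i < sp_size H)
    sp_coef H i w * (W (sp_time H i.+1) w - W (sp_time H i) w).

(* Y is (a version of) the Ito integral of X: the L^2(P)-limit of the
   integrals of simple processes converging to X in L^2(dt x P). *)
Definition is_ito_integral (W X : R -> Omega -> R) (Y : Omega -> R) : Prop :=
  measurable_fun setT Y /\
  exists H : nat -> simple_process,
    (fun n => \int[P]_w \int[lebesgue_measure]_(t in `[0%R, T])
       ((X t w - sp_val (H n) t w) ^+ 2)%R%:E)%E @ \oo --> 0%E /\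
    (fun n => \int[P]_w ((Y w - sp_integral W (H n) w) ^+ 2)%R%:E)%E
       @ \oo --> 0%E.

(* The limit above is unique up to P-a.s. equality, so the choice of a version
   is immaterial; the default value 0 is only taken when no limit exists. *)
Definition ito_integral (W X : R -> Omega -> R) : Omega -> R :=
  xget (cst 0) [set Y | is_ito_integral W X Y].

(* ||Y||_q for real-valued Y *)
Definition rv_norm (q : R) (Y : Omega -> R) : \bar R :=
  Lnorm P q%:E (EFin \o Y).

Definition integrand_class (rho r q L : R) : set (R -> Omega -> R) :=
  [set X | [/\ progressively_measurable X,
      (Lnorm P q%:E
         (fun w => ereal_sup [set (`|X t w|)%:E | t in `[0%R, T]]) <= L%:E)%E
    & forall t z : R, 0 <= t <= T -> 0 <= z <= T ->
      (rv_norm r (fun w => X t w - X z w)%R <= (L * `|t - z| `^ rho)%:E)%E]].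

End FilteredSpace.

Section Disturbances.
Context {R : realType}.
Variable T : R.

Definition strip : set (R * R) := `[0, T] `*` [set: R].

(* |y|^s with the convention |y|^0 = 0 (whereas 0 `^ 0 = 1 for [powR]). *)
Definition abs_pow (y s : R) : R := if s == 0 then 0 else `|y| `^ s.

Definition K1 : set (R * R -> R) :=
  [set p : R * R -> R | measurable_fun strip p /\
    forall t y : R, 0 <= t <= T -> `|p (t, y)| <= 1 + `|y|].

(* p is C^{1,2} on [0, T] x R, with partial derivatives pt, py and pyy; the
   time derivative is one-sided at t = 0 and t = T. *)
Definition is_C12 (p pt py pyy : R * R -> R) : Prop :=
  [/\ [/\ {within strip, continuous p}, {within strip, continuous pt},
          {within strip, continuous py} & {within strip, continuous pyy}],
      forall t y : R, 0 <= t <= T ->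
        (p (u, y) - p (t, y)) / (u - t) @[u --> within `[0, T] (t^')] --> pt (t, y),
      forall t y : R, 0 <= t <= T ->
        is_derive y 1 (fun u => p (t, u)) (py (t, y))
    & forall t y : R, 0 <= t <= T ->
        is_derive y 1 (fun u => py (t, u)) (pyy (t, y))].

Definition K2 (s : R) : set (R * R -> R) :=
  [set p | exists pt py pyy, is_C12 p pt py pyy /\
    forall t y : R, 0 <= t <= T ->
      Num.max `|pt (t, y)| (Num.max `|py (t, y)| `|pyy (t, y)|)
        <= 1 + abs_pow y s].

(* The processes Z(t) + delta * p(t, Z(t)), t in [0, T], with p in K. *)
Definition noisy {Omega : Type} (K : set (R * R -> R)) (delta : R)
    (Z : R -> Omega -> R) : set (R -> Omega -> R) :=
  [set Z' | exists2 p, K p &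
    forall t w, 0 <= t <= T -> Z' t w = Z t w + delta * p (t, Z t w)].

Definition noisy_integrands {Omega : Type} (X : R -> Omega -> R) (delta1 : R) :=
  noisy K1 delta1 X.

Definition noisy_wieners {Omega : Type} (W : R -> Omega -> R) (s delta2 : R) :=
  noisy (K2 s) delta2 W.

Record algorithm := Algorithm {
  nX : nat;
  nW : nat;
  nX_gt0 : (0 < nX)%N;
  nW_gt0 : (0 < nW)%N;
  ptsX : 'I_nX -> R;
  ptsW : 'I_nW -> R;
  ptsX_in : forall j, 0 <= ptsX j <= T;
  ptsW_in : forall j, 0 <= ptsW j <= T;
  ptsX_inj : injective ptsX;
  ptsW_inj : injective ptsW;
  phi : (nX + nW).-tuple R -> R;
  phi_meas : measurable_fun setT phi }.

Arguments ptsX A : clear implicits, rename.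
Arguments ptsW A : clear implicits, rename.
Arguments phi A : clear implicits, rename.

Definition run {Omega : Type} (A : algorithm) (X' W' : R -> Omega -> R)
    (w : Omega) : R :=
  phi A (cat_tuple [tuple X' (ptsX A j) w | j < nX A]
                   [tuple W' (ptsW A j) w | j < nW A]).

Definition Phi (n : nat) : set algorithm := [set A | (nX A + nW A <= n)%N].

End Disturbances.

Arguments ptsX {R T} A : rename.
Arguments ptsW {R T} A : rename.
Arguments phi {R T} A : rename.
Arguments Phi {R} T n.

Section Errors.
Context {R : realType} {d : measure_display} {Omega : measurableType d}.
Variables (P : probability Omega R) (F : R -> set (set Omega)).
Variables (W : R -> Omega -> R) (T rho r q L s delta1 delta2 : R).

Definition worst_case_error (A : algorithm T) : \bar R :=
  ereal_sup [set
    ereal_sup [set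
      rv_norm P r (fun w => ito_integral P F T W X w - run A XW.1 XW.2 w)
    | XW in noisy_integrands T X delta1 `*` noisy_wieners T W s delta2]
  | X in integrand_class P F T rho r q L].

Definition minimal_error (n : nat) : \bar R :=
  ereal_inf [set worst_case_error A | A in Phi T n].

End Errors.

(* Main.v *)
(** Adversary argument. If two integrands [f] and [- f] produce the same noisy
    data, an algorithm returns the same value on both, so the larger of the two
    errors is at least half the distance between the integrals. This distance
    is bounded below by testing against [V = W_T - W_0]: the product formula
    [E (I(f) * V) = gauss_var * \int_0^T f] passes from simple processes to the
    limit, and Hölder's inequality turns it into a bound on the [L^r] norm.

    For the term [delta1], [f] is the constant [delta1], which the disturbances
    [-1] and [+1] hide completely. For the term [n ^ (- rho)], [f] is a multiple
    of the [rho]-th power of the distance to the nodes of the algorithm, and no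
    disturbance is used.

    As [ito_integral] is [0] when no limit exists, the Itô integral of a Hölder
    continuous [f] must be shown to exist: its dyadic left Riemann sums are
    geometrically Cauchy in mean square, hence converge almost surely, and
    Fatou's lemma identifies the limit. *)

Require Import Defs.
From HB Require Import structures.
From mathcomp Require Import all_boot all_order all_algebra.
From mathcomp Require Import all_classical all_reals all_analysis.
From mathcomp Require Import measurable_realfun ring lra.

Import Order.TTheory GRing.Theory Num.Theory.
Import numFieldNormedType.Exports.

Local Open Scope classical_set_scope.
Local Open Scope ring_scope.

Set Implicit Arguments.
Unset Strict Implicit.
Unset Printing Implicit Defensive.

(** * Gaussian moments *)

Section gaussian_moments.
Context {R : realType}.
Local Notation mu := (@lebesgue_measure R).

(** The normal law is dominated by Lebesgue measure, and its Radon-Nikodym derivative agrees almost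
    everywhere with [normal_pdf], since both have the same integral over every measurable set. *)
Lemma ge0_integral_normal_prob (m s : R) (f : R -> \bar R) :
  measurable_fun [set: R] f -> (forall x, 0 <= f x)%E ->
  (\int[normal_prob m s]_x f x = \int[mu]_x (f x * (normal_pdf m s x)%:E))%E.
Proof.
move=> mf f0; have dom := normal_prob_dominates m s.
rewrite -(Radon_Nikodym_SigmaFinite.change_of_variables dom f0)//.
have iRN := Radon_Nikodym_SigmaFinite.f_integrable dom.
apply: ae_eq_integral => //.
- by apply: emeasurable_funM => //; exact: measurable_int iRN.
- apply: emeasurable_funM => //; apply/measurable_EFinP.
  exact: measurable_normal_pdf.
- apply: ae_eqe_mul2l; apply: integral_ae_eq => //.
  + by apply/measurable_EFinP; exact: measurable_normal_pdf.
  + by move=> E _ mE; rewrite -Radon_Nikodym_SigmaFinite.f_integral.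
Qed.

Lemma continuous_sqr_normal_pdf (s : R) : s != 0 ->
  continuous (fun x : R => x ^+ 2 * normal_pdf 0 s x).
Proof.
move=> s0 x; apply: cvgM; first exact: (@sqr_continuous R).
exact: continuous_normal_pdf.
Qed.

Lemma scale_pinfty (s : R) : 0 < s -> (fun x : R => s * x) x @[x --> +oo] --> +oo.
Proof.
move=> s0; exact: (gt0_cvgMry s0 (cvg_id)).
Qed.

Lemma scale_ninfty (s : R) : 0 < s -> (fun x : R => s * x) x @[x --> -oo] --> -oo.
Proof. by move=> s0; exact: (gt0_cvgMrNy s0 (cvg_id)). Qed.

Lemma normal_pdf_scale (s x : R) : 0 < s ->
  s * normal_pdf 0 s (s * x) = normal_pdf 0 1 x.
Proof.
move=> s0; rewrite !normal_pdfE ?oner_neq0 ?gt_eqF//.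
rewrite /normal_peak /normal_fun !subr0 mulrA; congr (_ * expR _).
- rewrite expr1n mul1r -mulrnAr sqrtrM ?sqr_ge0// sqrtr_sqr gtr0_norm//.
  by rewrite invfM mulrA divff ?gt_eqF// mul1r.
- by field; rewrite gt_eqF.
Qed.

(* Equal to 1, but only [0 < gauss_var < +oo] is used. *)
Definition gauss_var : \bar R := (\int[normal_prob 0 1]_x ((x : R) ^+ 2)%:E)%E.

(** The substitution [s * x] reduces the law of standard deviation [s] to the standard one: its
    derivative [s] is absorbed by [normal_pdf_scale], and the square leaves the factor [s ^+ 2]. *)
Lemma normal_second_moment (s : R) : 0 < s ->
  (\int[normal_prob 0 s]_x ((x : R) ^+ 2)%:E = (s ^+ 2)%:E * gauss_var)%E.
Proof.
move=> s0; have mX2 : measurable_fun [set: R] (fun x : R => (x ^+ 2)%:E).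
  by apply/measurable_EFinP; exact: measurable_funX.
rewrite /gauss_var !ge0_integral_normal_prob//; last 2 first.
  by move=> x; rewrite lee_fin sqr_ge0.
  by move=> x; rewrite lee_fin sqr_ge0.
have dF : derive1 (fun x : R => s * x) = cst s.
  apply/funext => x; rewrite derive1E.
  by rewrite deriveM// derive_cst derive_id scaler0 addr0 /GRing.scale/= mulr1.
under eq_integral do rewrite -EFinM.
rewrite (@increasing_ge0_integration_by_substitutionT _ (fun x => s * x)).
- rewrite dF -ge0_integralZl//; last 3 first.
  + apply: emeasurable_funM => //; apply/measurable_EFinP.
    exact: measurable_normal_pdf.
  + by move=> x _; rewrite -EFinM lee_fin mulr_ge0 ?sqr_ge0 ?normal_pdf_ge0.
  + by rewrite lee_fin sqr_ge0.
  apply: eq_integral => x _.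
  rewrite -!EFinM /=; congr EFin.
  rewrite -(normal_pdf_scale x s0) mulrfctE /=; ring.
- by move=> x y xy; rewrite ltr_pM2l.
- by rewrite dF; exact: cst_continuous.
- by rewrite dF; exact: is_cvg_cst.
- by rewrite dF; exact: is_cvg_cst.
- by move=> x; exact: derivableM.
- exact: scale_ninfty.
- exact: scale_pinfty.
- by apply: continuous_sqr_normal_pdf; rewrite gt_eqF.
- by move=> x; rewrite mulr_ge0 ?sqr_ge0 ?normal_pdf_ge0.
Qed.

(** If the second moment vanished, the law would be carried by the point 0. This point is
    Lebesgue-null, hence null for the normal law, which contradicts total mass 1. *)
Lemma gauss_var_gt0 : (0 < gauss_var)%E.
Proof.
rewrite lt0e integral_ge0 ?andbT; last by move=> x _; rewrite lee_fin sqr_ge0.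
apply/negP => /eqP v0.
have mX2 : measurable_fun [set: R] (fun x : R => (x ^+ 2)%:E).
  by apply/measurable_EFinP; exact: measurable_funX.
have : ae_eq (normal_prob 0 1) setT (fun x : R => (x ^+ 2)%:E) (cst 0%E).
  apply/(ae_eq_integral_abs (normal_prob 0 1) measurableT mX2).
  rewrite -[RHS]v0; apply: eq_integral => x _.
  by rewrite gee0_abs// lee_fin sqr_ge0.
case=> N [mN N0 sub].
have sub' : ~` [set 0 : R] `<=` N.
  move=> x x0; apply: sub => /= /(_ I) [] /eqP.
  by rewrite sqrf_eq0 => /eqP.
have m0 : normal_prob 0 1 [set 0 : R] = 0%E.
  have /null_content_dominatesP := normal_prob_dominates (0:R) 1; apply => //.
  exact: lebesgue_measure_set1.
have : (normal_prob 0 1 (N `|` [set 0%R]) <= 0)%E.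
  apply: le_trans (measureU2 _ mN _) _ => //.
  by move: N0 m0 => /= -> ->; rewrite adde0.
rewrite (_ : N `|` _ = setT); first by rewrite probability_setT leNgt lte01.
rewrite -subTset => x _; have [->|x0] := eqVneq x 0; first by right.
by left; apply: sub'; exact/eqP.
Qed.

Lemma gauss_var_lty : (gauss_var < +oo)%E.
Proof.
have mX2 : measurable_fun [set: R] (fun x : R => (x ^+ 2)%:E).
  by apply/measurable_EFinP; exact: measurable_funX.
(* The integrand is dominated by a multiple of the density of variance 2:
   [x ^+ 2 * expR (- (x ^+ 2 / 4)) <= 4], because [1 + u <= expR u] at [u = x ^+ 2 / 4]. The
   quotient in [C] adjusts the peaks. *)
pose C : R := 4 * (normal_peak 1 / normal_peak (Num.sqrt 2)).
have s20 : Num.sqrt 2 != 0 :> R by rewrite sqrtr_eq0 -ltNge.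
rewrite /gauss_var ge0_integral_normal_prob//; last first.
  by move=> x; rewrite lee_fin sqr_ge0.
apply: (@le_lt_trans _ _ (\int[mu]_x (C%:E * (normal_pdf 0 (Num.sqrt 2) x)%:E))%E).
  apply: ge0_le_integral => //.
  - by move=> x _; rewrite -EFinM lee_fin mulr_ge0 ?sqr_ge0 ?normal_pdf_ge0.
  - apply: emeasurable_funM => //; apply/measurable_EFinP.
    exact: measurable_normal_pdf.
  - apply: emeasurable_funM => //; apply/measurable_EFinP.
    exact: measurable_normal_pdf.
  - move=> x _; rewrite -!EFinM lee_fin !normal_pdfE ?oner_neq0//.
    rewrite /C (_ : 4 * _ * _ = 4 * normal_peak 1 * normal_fun 0 (Num.sqrt 2) x); last first.
      by field; rewrite gt_eqF// normal_peak_gt0.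
    rewrite mulrCA -mulrA [leRHS]mulrCA ler_wpM2l ?normal_peak_ge0//.
    rewrite /normal_fun !subr0 sqr_sqrtr// expr1n.
    have -> : - x ^+ 2 / (1 *+ 2) = - x ^+ 2 / (2 *+ 2) + - (x ^+ 2 / (2 *+ 2)).
      by field.
    rewrite expRD mulrCA [leRHS]mulrC ler_wpM2l ?expR_ge0//.
    rewrite expRN ler_pdivrMr ?expR_gt0//.
    have := expR_ge1Dx (x ^+ 2 / (2 *+ 2)); lra.
rewrite ge0_integralZl//.
- by rewrite integral_normal_pdf mule1 ltry.
- by apply/measurable_EFinP; exact: measurable_normal_pdf.
- by move=> x _; rewrite lee_fin normal_pdf_ge0.
- by rewrite lee_fin mulr_ge0// divr_ge0 ?normal_peak_ge0.
Qed.

Let opp_mixin := isMeasurableFun.Build _ _ (measurableTypeR R)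
  (measurableTypeR R) _ (@oppr_measurable R setT).
Let opp_mfun : {mfun measurableTypeR R >-> measurableTypeR R} :=
  HB.pack (-%R : measurableTypeR R -> measurableTypeR R) opp_mixin.

(** The density is even and Lebesgue measure is invariant under negation. This symmetry serves to
    make the first moment vanish. *)
Lemma pushforward_opp_normal (s : R) (A : set R) : s != 0 -> measurable A ->
  pushforward (normal_prob 0 s) opp_mfun A = normal_prob 0 s A.
Proof.
move=> s0 mA; rewrite /pushforward /normal_prob.
have mpdf : measurable_fun [set: R] (fun x => (normal_pdf 0 s x)%:E).
  by apply/measurable_EFinP; exact: measurable_normal_pdf.
transitivity (\int[mu]_(x in opp_mfun @^-1` A)
    ((fun x => (normal_pdf 0 s x)%:E) \o opp_mfun) x)%E.
  apply: eq_integral => x _ /=; congr EFin.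
  by rewrite !normal_pdfE// /normal_fun !subr0 sqrrN.
rewrite -ge0_integral_pushforward//.
- by apply: (eq_measure_integral mu) => B mB _; exact: lebesgue_measureN.
- exact: measurable_funTS.
- by move=> x _; rewrite lee_fin normal_pdf_ge0.
Qed.

(** By symmetry the integral equals its own opposite, and integrability makes it finite. *)
Lemma normal_first_moment (s : R) : s != 0 ->
  (normal_prob 0 s).-integrable setT (fun x : R => x%:E) ->
  (\int[normal_prob 0 s]_x (x : R)%:E = 0)%E.
Proof.
move=> s0 ix.
have iNx : (normal_prob 0 s).-integrable setT (fun x : R => (- x)%:E).
  by under eq_fun do rewrite EFinN; exact: integrableN.
have : (\int[normal_prob 0 s]_x (x : R)%:E = \int[normal_prob 0 s]_x (- (x : R))%:E)%E.
  transitivity (\int[pushforward (normal_prob 0 s) opp_mfun]_x (x : R)%:E)%E.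
    apply: eq_measure_integral => B mB _.
    by apply/esym; exact: pushforward_opp_normal.
  rewrite integral_pushforward//.
under [RHS]eq_integral do rewrite EFinN.
rewrite integralN; last exact: integrable_add_def.
have := integrable_fin_num measurableT ix.
case: (integral _ _ _) => //= r _ [] h; congr EFin; lra.
Qed.

End gaussian_moments.

(** * Square-integrable random variables and independence *)

Section square_integrable.
Context {R : realType} {d : measure_display} {Omega : measurableType d}.
Variable P : probability Omega R.

(** Measurability of [Z] is a separate clause because it does not follow from that of [Z ^+ 2]. *)
Definition sq_integrable (Z : Omega -> R) :=
  measurable_fun setT Z /\ P.-integrable setT (fun w => (Z w ^+ 2)%:E).

Lemma sq_integrableP (Z : Omega -> R) : measurable_fun setT Z ->
  (\int[P]_w (Z w ^+ 2)%:E < +oo)%E -> sq_integrable Z.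
Proof.
move=> mZ Zoo; split=> //; apply/integrableP; split.
  by apply/measurable_EFinP; exact: measurable_funX.
by under eq_integral do rewrite gee0_abs ?lee_fin ?sqr_ge0//.
Qed.

Lemma le_integrableR (f g : Omega -> R) : measurable_fun setT f ->
  (forall w, `|f w| <= g w) -> P.-integrable setT (EFin \o g) ->
  P.-integrable setT (EFin \o f).
Proof.
move=> mf fg; apply: le_integrable => //; first exact/measurable_EFinP.
by move=> w _ /=; rewrite lee_fin (le_trans (fg w))// ler_norm.
Qed.

Lemma integrable_cstR (c : R) : P.-integrable setT (EFin \o cst c).
Proof. exact: finite_measure_integrable_cst. Qed.

Lemma integrableDR (f g : Omega -> R) : P.-integrable setT (EFin \o f) ->
  P.-integrable setT (EFin \o g) ->
  P.-integrable setT (EFin \o (fun w => f w + g w)).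
Proof. by move=> mf mg; apply: (integrableD measurableT mf mg). Qed.

Lemma integrableZR (c : R) (f : Omega -> R) : P.-integrable setT (EFin \o f) ->
  P.-integrable setT (EFin \o (fun w => c * f w)).
Proof. by move=> mf; exact: (integrableZl measurableT c mf). Qed.

Lemma integrableM_sq (X Y : Omega -> R) : sq_integrable X -> sq_integrable Y ->
  P.-integrable setT (EFin \o (fun w => X w * Y w)).
Proof.
move=> [mX iX] [mY iY].
apply: (@le_integrableR _ (fun w => X w ^+ 2 + Y w ^+ 2)).
- exact: measurable_funM.
- move=> w; rewrite normrM -(real_normK (num_real (X w))).
  rewrite -(real_normK (num_real (Y w))).
  have := sqr_ge0 (`|X w| - `|Y w|); have := mulr_ge0 (normr_ge0 (X w)) (normr_ge0 (Y w)); nra.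
- exact: integrableDR.
Qed.

Lemma sq_integrable_cst (c : R) : sq_integrable (cst c).
Proof. by split=> //; exact: (integrable_cstR (c ^+ 2)). Qed.

Lemma integrable_sq (X : Omega -> R) : sq_integrable X ->
  P.-integrable setT (EFin \o X).
Proof.
move=> sX; have := integrableM_sq sX (sq_integrable_cst 1).
by under eq_fun do rewrite /= mulr1.
Qed.

Lemma sq_integrableM (X Y : Omega -> R) (M : R) : measurable_fun setT X ->
  (forall w, `|X w| <= M) -> sq_integrable Y ->
  sq_integrable (fun w => X w * Y w).
Proof.
move=> mX XM [mY iY]; split; first exact: measurable_funM.
apply: (@le_integrableR _ (fun w => M ^+ 2 * Y w ^+ 2)).
- by apply: measurable_funX; exact: measurable_funM.
- move=> w; rewrite ger0_norm ?sqr_ge0// exprMn ler_wpM2r ?sqr_ge0//.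
  rewrite -(real_normK (num_real (X w))) lerXn2r ?nnegrE//.
  by rewrite (le_trans _ (XM w)).
- exact: integrableZR.
Qed.

Lemma sq_integrableZ (c : R) (Y : Omega -> R) :
  sq_integrable Y -> sq_integrable (fun w => c * Y w).
Proof. by apply: (@sq_integrableM _ _ `|c|). Qed.

Lemma sq_integrableD (X Y : Omega -> R) : sq_integrable X -> sq_integrable Y ->
  sq_integrable (fun w => X w + Y w).
Proof.
move=> [mX iX] [mY iY]; split; first exact: measurable_funD.
apply: (@le_integrableR _ (fun w => 2 * (X w ^+ 2 + Y w ^+ 2))).
- by apply: measurable_funX; exact: measurable_funD.
- move=> w; rewrite ger0_norm ?sqr_ge0//.
  have := sqr_ge0 (X w - Y w); nra.
- by apply: integrableZR; exact: integrableDR.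
Qed.

Lemma sq_integrableB (X Y : Omega -> R) : sq_integrable X -> sq_integrable Y ->
  sq_integrable (fun w => X w - Y w).
Proof.
move=> sX /(sq_integrableZ (-1)) sY.
by have := sq_integrableD sX sY; under eq_fun do rewrite mulN1r.
Qed.

Lemma EFin_Rintegral (f : Omega -> R) : P.-integrable setT (EFin \o f) ->
  ((\int[P]_w f w)%R%:E = \int[P]_w (f w)%:E)%E.
Proof. by move=> fi; rewrite fineK//; exact: integrable_fin_num. Qed.

(** The integral of [(a * X + Y) ^+ 2] is a quadratic polynomial in [a] that is nonnegative
    everywhere. *)
Lemma cauchy_schwarz (X Y : Omega -> R) : sq_integrable X -> sq_integrable Y ->
  (\int[P]_w (X w * Y w)) ^+ 2
  <= (\int[P]_w (X w ^+ 2)) * (\int[P]_w (Y w ^+ 2)).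
Proof.
move=> sX sY; have [mX iX] := sX; have [mY iY] := sY.
have iXY := integrableM_sq sX sY.
set A := (\int[P]_w (X w ^+ 2)); set B := (\int[P]_w (X w * Y w)).
set C := (\int[P]_w (Y w ^+ 2)).
have q (a : R) : 0 <= a ^+ 2 * A + 2 * a * B + C.
  rewrite /A /B /C -!RintegralZl// -!RintegralD//.
  - apply: Rintegral_ge0 => w _.
    by have := sqr_ge0 (a * X w + Y w); congr (_ <= _); ring.
  - by apply: integrableDR; apply: integrableZR.
  - exact: integrableZR.
  - exact: integrableZR.
have A0 : 0 <= A by apply: Rintegral_ge0 => w _; exact: sqr_ge0.
have [A00|An0] := eqVneq A 0.
  rewrite A00 mul0r; have [->|Bn0] := eqVneq B 0; first by rewrite expr0n.
  (* When [A = 0] the polynomial is affine in [a]; at this point it would take the value [-1]. *)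
  have := q (- (C + 1) / (2 * B)); rewrite A00 mulr0 add0r.
  have -> : 2 * (- (C + 1) / (2 * B)) * B = - (C + 1) by field.
  lra.
(* The minimiser of the quadratic. *)
have := q (- B / A).
have -> : (- B / A) ^+ 2 * A + 2 * (- B / A) * B + C = C - B ^+ 2 / A by field.
have Ap : 0 < A by rewrite lt0r An0.
by rewrite subr_ge0 ler_pdivrMr// mulrC.
Qed.

End square_integrable.

Section independence.
Context {R : realType} {d : measure_display} {Omega : measurableType d}.
Variable P : probability Omega R.

(** Independence says that the joint law is the product of the marginal laws, and Fubini's theorem
    then splits the integral. The function [g] allows both the increment [D] and its square. *)
Lemma Rintegral_indep (Z D : {mfun Omega >-> R}) (g : R -> R) :
  (forall A B : set R, measurable A -> measurable B ->
    P (Z @^-1` A `&` D @^-1` B) = (P (Z @^-1` A) * P (D @^-1` B))%E) ->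
  measurable_fun [set: R] g ->
  P.-integrable setT (EFin \o Z) ->
  P.-integrable setT (EFin \o (g \o D)) ->
  P.-integrable setT (EFin \o (fun w => Z w * g (D w))) ->
  \int[P]_w (Z w * g (D w)) = (\int[P]_w Z w) * (\int[P]_w g (D w)).
Proof.
move=> ind mg iZ iD iZD.
have mZD : measurable_fun setT (fun w => (Z w, D w)).
  exact: measurable_fun_pair.
pose zd : {mfun Omega >-> (R * R)%type} :=
  HB.pack (fun w => (Z w, D w)) (isMeasurableFun.Build _ _ _ _ _ mZD).
pose h (z : R * R) := (z.1 * g z.2)%:E.
have mh : measurable_fun setT h.
  apply/measurable_EFinP; apply: measurable_funM => //.
  exact: measurableT_comp.
(* The two measures agree on rectangles, which determine the product measure. *)
have law : forall X, measurable X ->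
    (distribution P Z \x distribution P D)%E X = pushforward P zd X.
  by apply: product_measure_unique => A B mA mB; rewrite -ind.
have ih : (distribution P Z \x distribution P D)%E.-integrable setT h.
  have : (pushforward P zd).-integrable setT h.
    exact: integrable_pushforward.
  move=> /integrableP[_ hoo]; apply/integrableP; split; first exact: mh.
  by rewrite (eq_measure_integral (pushforward P zd)) => [//|A mA _]; exact: law.
have E : (\int[P]_w (Z w * g (D w))%:E
    = \int[distribution P Z]_x \int[distribution P D]_y h (x, y))%E.
  rewrite (integral12_prod_meas1 ih).
  rewrite (eq_measure_integral (pushforward P zd)) => [|A mA _]; last exact: law.
  rewrite integral_pushforward//.
have mg' : measurable_fun [set: R] (EFin \o g) by exact/measurable_EFinP.
have iD' : (distribution P D).-integrable setT (EFin \o g).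
  exact: integrable_pushforward.
have iZ' : (distribution P Z).-integrable setT EFin.
  exact: integrable_pushforward.
have ED : (\int[distribution P D]_y (g y)%:E = \int[P]_w (g (D w))%:E)%E.
  exact: (integral_pushforward _ mg').
have EZ : (\int[distribution P Z]_y y%:E = \int[P]_w (Z w)%:E)%E.
  exact: (integral_pushforward _ (@EFin_measurable _ _)).
rewrite /Rintegral E -fineM ?integrable_fin_num//; congr fine.
transitivity (\int[distribution P Z]_x (x%:E * (\int[P]_w (g (D w)))%R%:E))%E.
  apply: eq_integral => x _; rewrite EFin_Rintegral// -ED -integralZl//.
rewrite integralZr// EZ EFin_Rintegral//.
Qed.

End independence.

(** * Wiener increments *)

Section wiener_increments.
Context {R : realType} {d : measure_display} {Omega : measurableType d}.
Variables (P : probability Omega R) (F : R -> set (set Omega)).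
Variable W : R -> Omega -> R.
Hypotheses (hF : usual_conditions P F) (hW : is_wiener P F W).
Local Notation kappa := (fine (@gauss_var R)).

(** [F t] is already a sigma-algebra, so the one generated in [g_sigma_algebraType] contains no
    further sets. *)
Lemma F_measurable_preimage (t : R) (Y : Omega -> R) (B : set R) : 0 <= t ->
  F_measurable F t Y -> measurable B -> F t (Y @^-1` B).
Proof.
case: hF => _ sF _ _ _ t0 mY mB.
have := mY measurableT B mB; rewrite setTI.
by rewrite /measurable/= (sigma_algebra_id (proj1 (sF t t0))).
Qed.

Lemma F_measurableW (t : R) (Y : Omega -> R) : 0 <= t ->
  F_measurable F t Y -> measurable_fun setT Y.
Proof.
move=> t0 mY _ B mB; rewrite setTI.
case: hF => _ sF _ _ _; apply: (proj2 (sF t t0)).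
exact: F_measurable_preimage.
Qed.

Lemma F_measurable_mono (t u : R) (Y : Omega -> R) : 0 <= t -> t <= u ->
  F_measurable F t Y -> F_measurable F u Y.
Proof.
move=> t0 tu mY _ B mB; rewrite setTI; apply: sub_sigma_algebra.
case: hF => _ _ mF _ _; apply: (mF t u) => //.
exact: F_measurable_preimage.
Qed.

Lemma measurable_wiener (t : R) : 0 <= t -> measurable_fun setT (W t).
Proof. by move=> t0; apply: (F_measurableW t0); case: hW => + _ _ _ _; apply. Qed.

Variables (t u : R).
Hypotheses (t0 : 0 <= t) (tu : t < u).
Let u0 : 0 <= u := le_trans t0 (ltW tu).

Definition incr (w : Omega) : R := W u w - W t w.

Lemma measurable_incr : measurable_fun setT incr.
Proof. by apply: measurable_funB; exact: measurable_wiener. Qed.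

Let incr_mfun : {mfun Omega >-> measurableTypeR R} :=
  HB.pack incr (isMeasurableFun.Build _ _ Omega (measurableTypeR R) _ measurable_incr).

Let sd : R := Num.sqrt (u - t).

Let sd_gt0 : 0 < sd. Proof. by rewrite sqrtr_gt0 subr_gt0. Qed.

Let incr_law (B : set R) : measurable B ->
  pushforward P incr_mfun B = normal_prob 0 sd B.
Proof. by case: hW => _ _ _ _ law mB; rewrite -(law t u). Qed.

Lemma incr_second_moment :
  (\int[P]_w (incr w ^+ 2)%:E = (u - t)%:E * gauss_var)%E.
Proof.
have mX2 : measurable_fun [set: R] (fun x : R => (x ^+ 2)%:E).
  by apply/measurable_EFinP; exact: measurable_funX.
transitivity (\int[pushforward P incr_mfun]_x ((x : R) ^+ 2)%:E)%E.
  by rewrite ge0_integral_pushforward// => x _; rewrite lee_fin sqr_ge0.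
transitivity (\int[normal_prob 0 sd]_x ((x : R) ^+ 2)%:E)%E.
  by apply: eq_measure_integral => B mB _; exact: incr_law.
by rewrite normal_second_moment// sqr_sqrtr// subr_ge0 ltW.
Qed.

Lemma sq_integrable_incr : sq_integrable P incr.
Proof.
apply: sq_integrableP; first exact: measurable_incr.
by rewrite incr_second_moment lte_mul_pinfty ?lee_fin ?subr_ge0 ?ltW// gauss_var_lty.
Qed.

Lemma Rintegral_incr_sqr : \int[P]_w (incr w ^+ 2) = kappa * (u - t).
Proof.
rewrite /Rintegral incr_second_moment fineM//= 1?mulrC//.
by rewrite ge0_fin_numE ?gauss_var_lty// ltW// gauss_var_gt0.
Qed.

Lemma Rintegral_incr : \int[P]_w incr w = 0.
Proof.
have iX : (normal_prob 0 sd).-integrable setT (fun x : R => x%:E).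
  have : (pushforward P incr_mfun).-integrable setT (fun x : R => x%:E).
    apply: integrable_pushforward => //.
      exact: (@EFin_measurable _ _).
    exact: (integrable_sq sq_integrable_incr).
  move=> /integrableP[mX iX]; apply/integrableP; split => //.
  rewrite (eq_measure_integral (pushforward P incr_mfun)) => // B mB _.
  exact/esym/incr_law.
rewrite /Rintegral; have <- : (\int[pushforward P incr_mfun]_x (x : R)%:E
    = \int[P]_w (incr w)%:E)%E.
  have mE : measurable_fun [set: measurableTypeR R] (fun x : R => x%:E).
    exact: (@EFin_measurable R setT).
  have iE : P.-integrable (incr_mfun @^-1` setT) ((fun x : R => x%:E) \o incr_mfun).
    exact: (integrable_sq sq_integrable_incr).
  exact: (integral_pushforward (measurable_funP incr_mfun) mE iE measurableT).
rewrite (eq_measure_integral (normal_prob 0 sd)) => [|B mB _]; last exact: incr_law.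
by rewrite normal_first_moment// gt_eqF.
Qed.

Variable Z : Omega -> R.
Hypothesis FZ : F_measurable F t Z.

Let mZ := F_measurableW t0 FZ.

Let Z_mfun : {mfun Omega >-> R} :=
  HB.pack Z (isMeasurableFun.Build _ _ _ _ _ mZ).
Let D_mfun : {mfun Omega >-> R} :=
  HB.pack incr (isMeasurableFun.Build _ _ _ _ _ measurable_incr).

Let indep (A B : set R) : measurable A -> measurable B ->
    P (Z_mfun @^-1` A `&` D_mfun @^-1` B)
    = (P (Z_mfun @^-1` A) * P (D_mfun @^-1` B))%E.
Proof.
move=> mA mB; case: hW => _ _ _ ind _.
exact: (ind t u t0 tu _ _ (F_measurable_preimage t0 FZ mA) mB).
Qed.

(** The increment over [[t, u]] is independent of [F t] and has mean zero. This is what removes all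
    cross terms below. *)
Lemma Rintegral_mul_incr : sq_integrable P Z ->
  \int[P]_w (Z w * incr w) = 0.
Proof.
move=> sZ; have sD := sq_integrable_incr.
have := @Rintegral_indep _ _ _ P Z_mfun D_mfun id indep.
move=> -> //; last 3 first.
- exact: integrable_sq.
- exact: integrable_sq.
- exact: integrableM_sq.
by rewrite /= Rintegral_incr mulr0.
Qed.

(** The bound on [Z] gives integrability of the product through [M * incr w ^+ 2], so that no fourth
    moment of the increment enters. *)
Lemma Rintegral_mul_incr_sqr (M : R) : (forall w, `|Z w| <= M) ->
  \int[P]_w (Z w * incr w ^+ 2) = kappa * (u - t) * \int[P]_w Z w.
Proof.
move=> ZM; have [mD iD2] := sq_integrable_incr.
have := @Rintegral_indep _ _ _ P Z_mfun D_mfun (fun x => x ^+ 2) indep.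
move=> -> //; last 2 first.
- apply: (@le_integrableR _ _ _ P _ (cst M)) => //.
  exact: integrable_cstR.
- apply: (@le_integrableR _ _ _ P _ (fun w => M * incr w ^+ 2)).
  + by apply: measurable_funM => //; exact: measurable_funX.
  + by move=> w; rewrite normrM (@ger0_norm _ (_ ^+ 2)) ?sqr_ge0// ler_wpM2r ?sqr_ge0.
  + exact: integrableZR.
by rewrite /= Rintegral_incr_sqr mulrC.
Qed.

End wiener_increments.

(** * The Itô integral tested against a Wiener increment *)

(** Both integrals are suprema over the simple functions below the integrand, so no measurability is
    required. This suits functions of [w] that are themselves time integrals of a path. *)
Lemma ge0_le_integralT (d : measure_display) (T : measurableType d) (R : realType)
    (mu : {measure set T -> \bar R}) (f g : T -> \bar R) :
  (forall x, 0 <= f x)%E -> (forall x, f x <= g x)%E ->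
  (\int[mu]_x f x <= \int[mu]_x g x)%E.
Proof.
move=> f0 fg; have g0 x : (0 <= g x)%E by rewrite (le_trans (f0 x)).
rewrite !ge0_integralTE//; apply: le_ereal_sup => _ [h hf <-] /=.
by exists h => // x; exact: le_trans (hf x) (fg x).
Qed.

Lemma Rintegral_sum (d : measure_display) (T : measurableType d) (R : realType)
    (mu : {measure set T -> \bar R}) (D : set T) (n : nat) (f : 'I_n -> T -> R) :
  measurable D -> (forall i, mu.-integrable D (EFin \o f i)) ->
  mu.-integrable D (EFin \o (fun x => \sum_(i < n) f i x)) /\
  \int[mu]_(x in D) (\sum_(i < n) f i x) = \sum_(i < n) \int[mu]_(x in D) f i x.
Proof.
move=> mD; elim: n f => [|n IH] f fi.
  have -> : (fun x => \sum_(i < 0) f i x) = cst 0.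
    by apply/funext => x; rewrite big_ord0.
  split; first exact: integrable0.
  by rewrite Rintegral_cst// mul0r big_ord0.
have [i1 e1] := IH _ (fun i => fi (widen_ord (leqnSn n) i)).
have -> : (fun x => \sum_(i < n.+1) f i x)
    = (fun x => \sum_(i < n) f (widen_ord (leqnSn n) i) x + f ord_max x).
  by apply/funext => x; rewrite big_ord_recr.
split; first exact: (integrableD mD i1 (fi ord_max)).
by rewrite RintegralD// e1 big_ord_recr.
Qed.

Lemma integrable_bounded_itv (R : realType) (T : R) (g : R -> R) (M : R) :
  0 < T -> measurable_fun (`[0, T] : set R) g -> (forall t, `|g t| <= M) ->
  lebesgue_measure.-integrable `[0, T] (EFin \o g).
Proof.
move=> T0 mg gM; apply: measurable_bounded_integrable => //.
  by rewrite /= lebesgue_measure_itv/= lte_fin T0 ltry.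
exists M; split; first exact: num_real.
by move=> N MN t _; exact: le_trans (gM t) (ltW MN).
Qed.

(** Jensen's inequality for the uniform law on [[0, T]]: with [c] the average of [g], integrate
    [2 * c * g t - c ^+ 2 <= g t ^+ 2]. *)
Lemma sqr_Rintegral_itv (R : realType) (T : R) (g : R -> R) (M : R) : 0 < T ->
  measurable_fun (`[0, T] : set R) g -> (forall t, `|g t| <= M) ->
  ((((\int[lebesgue_measure]_(t in `[0, T]) g t) ^+ 2 / T)%R)%:E
   <= \int[lebesgue_measure]_(t in `[0%R, T]) (g t ^+ 2)%:E)%E.
Proof.
move=> T0 mg gM; have bint := @integrable_bounded_itv R T.
have ig := bint _ _ T0 mg gM.
have mg2 : measurable_fun `[0, T] (fun t => g t ^+ 2) by exact: measurable_funX.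
have ig2 : lebesgue_measure.-integrable `[0, T] (EFin \o (fun t => g t ^+ 2)).
  apply: (bint _ (M ^+ 2)) => // t; rewrite normrX lerXn2r ?nnegrE//.
  exact: le_trans (gM t).
set D := (X in (X ^+ 2 / T)%:E).
pose c := D / T.
have ic : lebesgue_measure.-integrable `[0, T] (EFin \o cst (c ^+ 2)).
  by apply: (bint _ `|c ^+ 2|).
have icg : lebesgue_measure.-integrable `[0, T] (EFin \o (fun t => 2 * c * g t)).
  exact: (integrableZl _ (2 * c) ig).
have -> : (\int[lebesgue_measure]_(t in `[0%R, T]) (g t ^+ 2)%:E
    = (\int[lebesgue_measure]_(t in `[0%R, T]) (g t ^+ 2))%:E)%E.
  by rewrite fineK//; exact: integrable_fin_num ig2.
have -> : D ^+ 2 / T = \int[lebesgue_measure]_(t in `[0, T]) (2 * c * g t - c ^+ 2).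
  rewrite RintegralB// RintegralZl// -/D Rintegral_cst//.
  rewrite /= lebesgue_measure_itv/= lte_fin T0 -EFinD /= subr0 /c.
  by field; rewrite gt_eqF.
rewrite lee_fin; apply: le_Rintegral => //.
- exact: (integrableB _ icg ic).
- by move=> t _; have := sqr_ge0 (g t - c); nra.
Qed.

Section simple_process_test.
Context {R : realType} {d : measure_display} {Omega : measurableType d}.
Variables (P : probability Omega R) (F : R -> set (set Omega)).
Variables (W : R -> Omega -> R) (T : R).
Hypotheses (hF : usual_conditions P F) (hW : is_wiener P F W) (T0 : 0 < T).
Local Notation kappa := (fine (@gauss_var R)).

Section one_process.
Variable H : simple_process F T.
Local Notation time := (sp_time H).
Local Notation xi := (sp_coef H).
Local Notation N := (sp_size H).

Lemma sp_time_le (i j : nat) : (i <= j <= N)%N -> time i <= time j.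
Proof.
elim: j => [|j IH] /andP[ij jN]; first by move: ij; rewrite leqn0 => /eqP ->.
move: ij; rewrite leq_eqVlt => /predU1P[->//|ij].
apply: le_trans (IH _) (ltW (sp_time_lt jN)).
by rewrite -ltnS ij ltnW.
Qed.

Lemma sp_time_ge0 (i : nat) : (i <= N)%N -> 0 <= time i.
Proof. by move=> iN; rewrite -(sp_time0 H); exact: sp_time_le. Qed.

Lemma sp_time_leT (i : nat) : (i <= N)%N -> time i <= T.
Proof. 
move=> iN; apply: (@le_trans _ _ (time N)); last by rewrite sp_timeT.
by apply: sp_time_le; rewrite iN leqnn.
Qed.

(** At [k = sp_size H] this is convertible to [sp_integral W H]; the free bound [k] permits
    induction along the partition. *)
Definition sp_partial (k : nat) (w : Omega) : R :=
  \sum_(i < k) xi i w * incr W (time i) (time i.+1) w.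

(** The time integral of the path of [sp_val H], as [Rintegral_sp_val] shows; there is no division
    by [T]. *)
Definition sp_mean (w : Omega) : R := \sum_(i < N) xi i w * (time i.+1 - time i).

Lemma F_measurable_wiener (t u : R) : 0 <= t -> t <= u -> F_measurable F u (W t).
Proof.
by move=> t0 tu; apply: (F_measurable_mono hF t0 tu); case: hW => + _ _ _ _; apply.
Qed.

Lemma measurable_sp_coef (i : nat) : (i < N)%N -> measurable_fun setT (xi i).
Proof.
move=> iN; apply: (F_measurableW hF (sp_time_ge0 (ltnW iN))).
exact: sp_coef_meas.
Qed.

Lemma integrable_sp_coef (i : nat) : (i < N)%N ->
  P.-integrable setT (EFin \o xi i).
Proof.
move=> iN; have [M xM] := sp_coef_bounded H.
apply: (@le_integrableR _ _ _ P _ (cst M)); first exact: measurable_sp_coef.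
- by move=> w; exact: xM.
- exact: integrable_cstR.
Qed.

Lemma sq_integrable_incr0 (t : R) : 0 <= t -> sq_integrable P (incr W 0 t).
Proof.
rewrite le_eqVlt => /predU1P[<-|t0]; last exact: (sq_integrable_incr hF hW).
by rewrite (_ : incr W 0 0 = cst 0); [exact: sq_integrable_cst|
  apply/funext => w; rewrite /incr subrr].
Qed.

(** Induction on [k]. Adaptedness and square integrability are carried along because the
    independence of the next increment [D] is applied to the partial sum itself. *)
Lemma sp_partial_test (k : nat) : (k <= N)%N ->
  [/\ F_measurable F (time k) (sp_partial k), sq_integrable P (sp_partial k) &
   \int[P]_w (sp_partial k w * incr W 0 (time k) w)
   = kappa * \sum_(i < k) (\int[P]_w xi i w) * (time i.+1 - time i)].
Proof.
elim: k => [|k IH] kN.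
  have -> : sp_partial 0 = cst 0.
    by apply/funext => w; rewrite /sp_partial big_ord0.
  split; [exact: measurable_cst|exact: sq_integrable_cst|].
  under eq_Rintegral do rewrite mul0r.
  by rewrite Rintegral_cst// mul0r big_ord0 mulr0.
have [FM sM EM] := IH (ltnW kN).
have tk0 := sp_time_ge0 (ltnW kN); have tlt := sp_time_lt kN.
have tk10 := sp_time_ge0 kN.
have Fxi := sp_coef_meas kN.
have mxi := measurable_sp_coef kN.
have [B xB] := sp_coef_bounded H.
pose D := incr W (time k) (time k.+1); pose V := incr W 0 (time k).
have sD : sq_integrable P D by exact: (sq_integrable_incr hF hW).
have sV : sq_integrable P V by exact: sq_integrable_incr0.
have FV : F_measurable F (time k) V.
  by apply: measurable_funB; exact: F_measurable_wiener.
have sxD : sq_integrable P (fun w => xi k w * D w).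
  by apply: (sq_integrableM (M := B)) => // w; exact: xB.
have sxV : sq_integrable P (fun w => xi k w * V w).
  by apply: (sq_integrableM (M := B)) => // w; exact: xB.
have pS : sp_partial k.+1 = fun w => sp_partial k w + xi k w * D w.
  by apply/funext => w; rewrite /sp_partial big_ord_recr.
split.
- rewrite pS; apply: measurable_funD.
    exact: (F_measurable_mono hF tk0 (ltW tlt)).
  apply: measurable_funM; first exact: (F_measurable_mono hF tk0 (ltW tlt)).
  apply: measurable_funB; first exact: F_measurable_wiener.
  exact: F_measurable_wiener (ltW tlt).
- by rewrite pS; exact: sq_integrableD.
(* Of the four products, the first is the induction hypothesis, the two that are linear in [D] have
   mean zero, and the one with [D w ^+ 2] yields the new summand. *)
have -> : \int[P]_w (sp_partial k.+1 w * incr W 0 (time k.+1) w)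
    = \int[P]_w (sp_partial k w * V w + sp_partial k w * D w
                 + (xi k w * V w * D w + xi k w * D w ^+ 2)).
  apply: eq_Rintegral => w _.
  have -> : incr W 0 (time k.+1) w = V w + D w by rewrite /V /D /incr; ring.
  by rewrite pS; ring.
have i1 := integrableM_sq sM sV; have i2 := integrableM_sq sM sD.
have i3 := integrableM_sq sxV sD.
have i4 : P.-integrable setT (EFin \o (fun w => xi k w * D w ^+ 2)).
  by under eq_fun do rewrite expr2 mulrA; exact: integrableM_sq.
rewrite !RintegralD//; [|exact: integrableDR|exact: integrableDR].
rewrite EM (Rintegral_mul_incr hF hW tk0 tlt FM sM).
rewrite (Rintegral_mul_incr hF hW tk0 tlt _ sxV); last exact: measurable_funM.
rewrite (Rintegral_mul_incr_sqr hF hW tk0 tlt Fxi (M := B)); last first.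
  by move=> w; exact: xB.
by rewrite big_ord_recr /=; ring.
Qed.

Lemma measurable_sp_mean : measurable_fun setT sp_mean.
Proof.
apply: (@measurable_sum _ _ _ _ _ _
  (fun (i : 'I_N) w => xi i w * (time i.+1 - time i))) => i.
by apply: measurable_funM => //; exact: measurable_sp_coef.
Qed.

Lemma Rintegral_sp_mean : P.-integrable setT (EFin \o sp_mean) /\
  \int[P]_w sp_mean w = \sum_(i < N) (\int[P]_w xi i w) * (time i.+1 - time i).
Proof.
have ix (i : 'I_N) : P.-integrable setT
    (EFin \o (fun w => xi i w * (time i.+1 - time i))).
  by under eq_fun do rewrite /= mulrC; apply: integrableZR;
    exact: integrable_sp_coef.
have [? ->] := Rintegral_sum measurableT ix; split => //.
by apply: eq_bigr => i _; rewrite RintegralZr//; exact: integrable_sp_coef.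
Qed.

Lemma sp_mean_bounded : exists M, forall w, `|sp_mean w| <= M.
Proof.
have [B xB] := sp_coef_bounded H.
exists (\sum_(i < N) B * `|time i.+1 - time i|) => w.
rewrite (le_trans (ler_norm_sum _ _ _))// ler_sum// => i _.
by rewrite normrM ler_wpM2r// xB.
Qed.

Lemma measurable_sp_val (w : Omega) (D : set R) : measurable_fun D (sp_val H ^~ w).
Proof.
by apply: (@measurable_sum _ _ _ _ _ _
  (fun (i : 'I_N) t => xi i w * \1_(`]time i, time i.+1]%classic) t)) => i;
  apply: measurable_funM.
Qed.

Lemma sp_val_bounded (w : Omega) : exists M, forall t, `|sp_val H t w| <= M.
Proof.
have [B xB] := sp_coef_bounded H.
exists (\sum_(i < N) B) => t.
rewrite (le_trans (ler_norm_sum _ _ _))// ler_sum// => i _.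
rewrite normrM -[leRHS]mulr1 ler_pM// ?xB// indicE.
by case: (_ \in _); rewrite ?normr1 ?normr0.
Qed.

Lemma Rintegral_sp_val (w : Omega) :
  \int[lebesgue_measure]_(t in `[0, T]) sp_val H t w = sp_mean w.
Proof.
pose f (i : 'I_N) t := xi i w * \1_(`]time i, time i.+1]%classic) t.
have i1 (i : 'I_N) : lebesgue_measure.-integrable `[0, T]
    (EFin \o (\1_(`]time i, time i.+1]%classic) : R -> R)).
  apply: (integrable_bounded_itv (M := 1)) => //.
  by move=> t; rewrite indicE; case: (_ \in _); rewrite ?normr1 ?normr0.
have fi i : lebesgue_measure.-integrable `[0, T] (EFin \o f i).
  exact: (integrableZl _ (xi i w) (i1 i)).
rewrite (proj2 (Rintegral_sum _ fi))//.
apply: eq_bigr => i _; rewrite RintegralZl//; congr (_ * _).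
rewrite /Rintegral integral_indic// setIidl.
  by rewrite /= lebesgue_measure_itv /= lte_fin sp_time_lt//= -EFinD.
apply: subset_itv; rewrite bnd_simp.
  by rewrite sp_time_ge0// ltnW.
by rewrite sp_time_leT.
Qed.

End one_process.

(** The formula is exact for the simple processes [H n]. Its defect for [Y] is controlled by the two
    mean-square errors of the approximation, hence is arbitrarily small. *)
Lemma ito_test (f : R -> R) (M : R) (Y : Omega -> R) :
  measurable_fun [set: R] f -> (forall t, `|f t| <= M) ->
  is_ito_integral P F T W (fun t _ => f t) Y ->
  sq_integrable P Y /\
  \int[P]_w (Y w * incr W 0 T w)
  = kappa * \int[lebesgue_measure]_(t in `[0, T]) f t.
Proof.
move=> mf fM [mY [H [Ha Hb]]].
set I0 := (X in _ = kappa * X); pose V := incr W 0 T.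
have sV : sq_integrable P V := sq_integrable_incr0 (ltW T0).
have EV2 : \int[P]_w (V w ^+ 2) = kappa * T.
  by rewrite (Rintegral_incr_sqr hF hW (lexx 0) T0) subr0.
have k0 : 0 <= kappa by rewrite fine_ge0// ltW// gauss_var_gt0.
have sI n : sq_integrable P (sp_integral W (H n)).
  by have [_ + _] := sp_partial_test (leqnn (sp_size (H n))).
have EI n : \int[P]_w (sp_integral W (H n) w * V w) = kappa * \int[P]_w sp_mean (H n) w.
  have [_ _] := sp_partial_test (leqnn (sp_size (H n))).
  by rewrite sp_timeT (Rintegral_sp_mean (H n)).2 => <-.
have step (e : R) : 0 < e -> sq_integrable P Y /\
    (\int[P]_w (Y w * V w) - kappa * I0) ^+ 2 <= 2 * kappa * T * e + 2 * kappa ^+ 2 * T * e.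
  move=> e0.
  have [n [an bn]] : exists n,
      (\int[P]_w \int[lebesgue_measure]_(t in `[0%R, T])
         ((f t - sp_val (H n) t w) ^+ 2)%R%:E < e%:E)%E /\
      (\int[P]_w ((Y w - sp_integral W (H n) w) ^+ 2)%R%:E < e%:E)%E.
    have small : nbhs (0%E : \bar R) [set x | (x < e%:E)%E].
      by apply: open_nbhs_nbhs; split; [exact: open_ereal_lt_ereal|rewrite /= lte_fin].
    have [n1 _ h1] : \forall n \near \oo, (\int[P]_w \int[lebesgue_measure]_(t in `[0%R, T])
         ((f t - sp_val (H n) t w) ^+ 2)%R%:E < e%:E)%E := Ha _ small.
    have [n2 _ h2] : \forall n \near \oo,
        (\int[P]_w ((Y w - sp_integral W (H n) w) ^+ 2)%R%:E < e%:E)%E := Hb _ small.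
    exists (maxn n1 n2); split; first exact/h1/leq_maxl.
    exact/h2/leq_maxr.
  have sYI : sq_integrable P (fun w => Y w - sp_integral W (H n) w).
    apply: sq_integrableP; last exact: lt_trans bn (ltry _).
    by apply: measurable_funB => //; case: (sI n).
  have sY : sq_integrable P Y.
    have := sq_integrableD sYI (sI n).
    by under eq_fun do rewrite subrK.
  split=> //.
  have [imean _] := Rintegral_sp_mean (H n).
  have mD : measurable_fun setT (fun w => I0 - sp_mean (H n) w).
    by apply: measurable_funB => //; exact: measurable_sp_mean.
  have [B HB] := sp_mean_bounded (H n).
  have sD : sq_integrable P (fun w => I0 - sp_mean (H n) w).
    under eq_fun do rewrite -[I0 - _]mulr1.
    apply: (sq_integrableM (M := `|I0| + B)) => //; last exact: sq_integrable_cst.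
    by move=> w; rewrite (le_trans (ler_normB _ _))// lerD.
  (* Jensen's inequality in time, path by path, bounds the squared error of the time integral by [T]
     times the squared error of the path. *)
  have ED2 : \int[P]_w ((I0 - sp_mean (H n) w) ^+ 2) <= T * e.
    rewrite -lee_fin EFin_Rintegral; last by case: sD.
    rewrite EFinM -lee_pdivrMl// -ge0_integralZl//; last 3 first.
    - by apply/measurable_EFinP; exact: measurable_funX.
    - by move=> w _; rewrite lee_fin sqr_ge0.
    - by rewrite lee_fin invr_ge0 ltW.
    apply: le_trans (ltW an); apply: ge0_le_integralT => w.
      by rewrite -EFinM lee_fin mulr_ge0 ?sqr_ge0// invr_ge0 ltW.
    have [C HC] := sp_val_bounded (H n) w.
    have iv : lebesgue_measure.-integrable `[0, T] (EFin \o sp_val (H n) ^~ w).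
      apply: (integrable_bounded_itv (M := C)) => //.
      exact: measurable_sp_val.
    have i_f : lebesgue_measure.-integrable `[0, T] (EFin \o f).
      by apply: (integrable_bounded_itv (M := M)) => //; exact: measurable_funTS.
    have := @sqr_Rintegral_itv R T (fun t => f t - sp_val (H n) t w) (M + C) T0.
    rewrite RintegralB// Rintegral_sp_val -/I0 mulrC EFinM; apply.
      apply: measurable_funB; first exact: measurable_funTS.
      exact: measurable_sp_val.
    by move=> t; rewrite (le_trans (ler_normB _ _))// lerD.
  (* The exact formula for [H n] is subtracted. The factor [1] puts the last integral in the form to
     which [cauchy_schwarz] applies with a constant function. *)
  have EYV : \int[P]_w (Y w * V w) - kappa * I0
     = \int[P]_w ((Y w - sp_integral W (H n) w) * V w)
       - kappa * \int[P]_w ((I0 - sp_mean (H n) w) * 1).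
    have iYV := integrableM_sq sY sV; have iIV := integrableM_sq (sI n) sV.
    under [X in _ = X - _]eq_Rintegral do rewrite mulrBl.
    rewrite RintegralB// EI.
    under [X in _ = _ - kappa * X]eq_Rintegral do rewrite mulr1.
    rewrite RintegralB//; last exact: integrable_cstR.
    rewrite Rintegral_cst//= probability_setT /=; ring.
  have c1 := cauchy_schwarz sYI sV.
  have c2 := cauchy_schwarz sD (sq_integrable_cst P 1).
  have b1 : \int[P]_w ((Y w - sp_integral W (H n) w) ^+ 2) <= e.
    by rewrite -lee_fin EFin_Rintegral ?ltW//; case: sYI.
  move: c2; under [X in _ <= _ * X -> _]eq_Rintegral do rewrite /= expr1n.
  rewrite Rintegral_cst//= probability_setT /= mulr1 mulr1 => c2.
  move: c1; rewrite EV2 EYV; set A := (X in X ^+ 2 <= _ -> _) => c1.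
  move: c2; set D := (X in X ^+ 2 <= _ -> _) => c2.
  have kT : 0 <= kappa * T by rewrite mulr_ge0// ltW.
  have b3 : A ^+ 2 <= e * (kappa * T) by apply: le_trans c1 _; rewrite ler_wpM2r.
  have b4 : D ^+ 2 <= T * e by exact: le_trans c2 ED2.
  have b5 : kappa ^+ 2 * D ^+ 2 <= kappa ^+ 2 * (T * e) by rewrite ler_wpM2l ?sqr_ge0.
  (* The parallelogram identity; dropping the last square bounds the left side by the first two
     terms. *)
  have -> : (A - kappa * D) ^+ 2
      = 2 * A ^+ 2 + 2 * (kappa ^+ 2 * D ^+ 2) - (A + kappa * D) ^+ 2 by ring.
  have -> : 2 * kappa * T * e + 2 * kappa ^+ 2 * T * e
      = 2 * (e * (kappa * T)) + 2 * (kappa ^+ 2 * (T * e)) by ring.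
  by rewrite lerBlDr ler_wpDr ?sqr_ge0// lerD// ler_wpM2l.
have [sY _] := step 1 ltr01; split => //.
set K := 2 * kappa * T + 2 * kappa ^+ 2 * T.
have K0 : 0 <= K by rewrite addr_ge0// !mulr_ge0// ?sqr_ge0// ltW.
apply/eqP; rewrite -subr_eq0 -sqrf_eq0 eq_le sqr_ge0 andbT.
apply/ler_addgt0Pl => e e0; rewrite addr0.
(* [K] is only known to be nonnegative, so the error level is [e / (K + 1)]. *)
have K1 : 0 < K + 1 by rewrite ltr_wpDl.
have [_] := step (e / (K + 1)) (divr_gt0 e0 K1).
rewrite -mulrDl -/K => /le_trans; apply.
by rewrite mulrA ler_pdivrMr// mulrC ler_pM2l// lerDl.
Qed.

End simple_process_test.

(** * Existence of the Itô integral *)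

(** Up to the constant [u 0], the sequence is the series of its increments, which converges
    absolutely. *)
Lemma is_cvg_of_summable_increments (R : realType) (u : nat -> R) :
  (\sum_(k <oo) (`|u k.+1 - u k|)%:E < +oo)%E -> cvgn u.
Proof.
move=> uoo.
have sub n : series (fun k => u k.+1 - u k) n = u n - u 0%N.
  by rewrite /series/= telescope_sumr.
have : cvgn (series (fun k => u k.+1 - u k)).
  apply: normed_cvg.
  have nd : nondecreasing_seq (series (fun k => `|u k.+1 - u k|)).
    by apply: nondecreasing_series => k _ _.
  apply: (nondecreasing_is_cvgn nd).
  exists (fine (\sum_(k <oo) (`|u k.+1 - u k|)%:E)%E) => _ [n _ <-].
  rewrite -lee_fin fineK; last first.
    by rewrite ge0_fin_numE//; apply: nneseries_ge0 => k _ _; rewrite lee_fin.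
  rewrite /series /= -sumEFin; apply: nneseries_lim_ge => k _ _.
  by rewrite lee_fin.
move=> cs; have -> : u = (fun n => series (fun k => u k.+1 - u k) n + u 0%N).
  by apply/funext => n; rewrite sub subrK.
by apply: is_cvgD => //; exact: is_cvg_cst.
Qed.

(** * Limits of geometrically Cauchy sequences in mean square *)

Section mean_square_limit.
Context {R : realType} {d : measure_display} {Omega : measurableType d}.
Variables (P : probability Omega R) (J : nat -> Omega -> R) (K theta : R).
Hypotheses (K0 : 0 <= K) (theta01 : 0 <= theta < 1).
Hypothesis sI : forall n, sq_integrable P (J n).
Hypothesis cauchyI : forall n m, (n <= m)%N ->
  \int[P]_w ((J m w - J n w) ^+ 2) <= (K * theta ^+ n) ^+ 2.

(** Cauchy-Schwarz against the constant 1 bounds the first absolute moment by the root of the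
    second. *)
Let integral_increment k :
  (\int[P]_w (`|J k.+1 w - J k w|)%:E <= (K * theta ^+ k)%:E)%E.
Proof.
have [t0 t1] := andP theta01.
have sD := sq_integrableB (sI k.+1) (sI k).
have mD : measurable_fun setT (fun w => J k.+1 w - J k w) by case: sD.
have sN : sq_integrable P (fun w => `|J k.+1 w - J k w|).
  split; first exact: measurableT_comp.
  by under eq_fun do rewrite real_normK ?num_real//; case: sD.
rewrite -EFin_Rintegral ?lee_fin; last exact: integrable_sq.
have c1 := cauchy_schwarz sN (sq_integrable_cst P 1).
have E1 : \int[P]_w (cst (1 : R) w ^+ 2) = 1.
  by under eq_Rintegral do rewrite /= expr1n; rewrite Rintegral_cst//= probability_setT mulr1.
have E2 : \int[P]_w (`|J k.+1 w - J k w| * cst (1 : R) w) = \int[P]_w `|J k.+1 w - J k w|.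
  by apply: eq_Rintegral => w _; rewrite mulr1.
have E3 : \int[P]_w (`|J k.+1 w - J k w| ^+ 2) = \int[P]_w ((J k.+1 w - J k w) ^+ 2).
  by apply: eq_Rintegral => w _; rewrite real_normK ?num_real.
move: c1; rewrite E1 E2 E3 mulr1 => /le_trans /(_ (cauchyI (leqnSn k))).
rewrite ler_pXn2r// nnegrE ?mulr_ge0 ?exprn_ge0//.
by apply: Rintegral_ge0.
Qed.

(** The sum of the absolute increments has finite expectation, being dominated by a geometric
    series. It is therefore finite almost everywhere. *)
Let ae_cvg : {ae P, forall w, cvgn (fun n => J n w)}.
Proof.
have [t0 t1] := andP theta01.
have mD k : measurable_fun setT (fun w => (`|J k.+1 w - J k w|)%:E).
  apply/measurable_EFinP; apply: measurableT_comp => //.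
  by apply: measurable_funB; case: (sI k.+1) => //; case: (sI k).
pose S w := (\sum_(k <oo) (`|J k.+1 w - J k w|)%:E)%E.
have S0 w : (0 <= S w)%E by apply: nneseries_ge0 => k _ _; rewrite lee_fin.
have mS : measurable_fun setT S.
  by apply: ge0_emeasurable_sum => [k w _ _|k _]; rewrite ?lee_fin//; exact: mD.
have iS : P.-integrable setT S.
  apply/integrableP; split => //.
  under eq_integral do rewrite gee0_abs//.
  rewrite integral_nneseries//.
  apply: (@le_lt_trans _ _ (\sum_(k <oo) (geometric K theta k)%:E)%E).
    by apply: lee_nneseries => [k _ _|k _]; [exact: integral_ge0|exact: integral_increment].
  have tn : `|theta| < 1 by rewrite ger0_norm.
  have cv : (fun n => (\sum_(0 <= k < n) (geometric K theta k)%:E)%E) @ \oo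
      --> (K * (1 - theta)^-1)%:E.
    under eq_fun do rewrite sumEFin.
    by apply: cvg_EFin; [exact: nearW|exact: cvg_geometric_series].
  by rewrite (cvg_lim _ cv)// ltry.
have := integrable_ae measurableT iS.
apply: filterS => w /(_ I); rewrite ge0_fin_numE//.
exact: is_cvg_of_summable_increments.
Qed.

Lemma mean_square_limit : exists Y : Omega -> R, measurable_fun setT Y /\
  forall n, (\int[P]_w ((Y w - J n w) ^+ 2)%:E <= ((K * theta ^+ n) ^+ 2)%:E)%E.
Proof.
(* The upper limit is defined and measurable everywhere, and equals the limit wherever the sequence
   converges in the reals. *)
pose Y w := fine (limn_esup (fun n => (J n w)%:E)).
have mI k : measurable_fun setT (J k) by case: (sI k).
have mY : measurable_fun setT Y.
  apply: (measurableT_comp (fine_measurable measurableT)).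
  by apply: measurable_fun_limn_esup => n; exact/measurable_EFinP.
have cvY : {ae P, forall w, (J n w) @[n --> \oo] --> Y w}.
  apply: filterS ae_cvg => w cI.
  have cE : (J n w)%:E @[n --> \oo] --> (limn (J ^~ w))%:E.
    by apply: cvg_EFin => //; exact: nearW.
  by rewrite /Y (cvg_limn_einf_sup cE).2.
exists Y; split => // n.
have mB m : measurable_fun setT (fun w => ((J (n + m)%N w - J n w) ^+ 2)%:E).
  by apply/measurable_EFinP; apply: measurable_funX; exact: measurable_funB.
(* The indices are shifted to [n + m], so that the Cauchy bound from [n] onwards covers every term
   to which Fatou's lemma is applied. *)
pose G w := limn_einf (fun m => ((J (n + m)%N w - J n w) ^+ 2)%:E).
have -> : (\int[P]_w ((Y w - J n w) ^+ 2)%:E = \int[P]_w G w)%E.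
  apply: ae_eq_integral => //.
  - by apply/measurable_EFinP; apply: measurable_funX; exact: measurable_funB.
  - rewrite /G /limn_einf; apply: measurableT_comp => //.
    apply: measurable_fun_limn_esup => m.
    exact: measurableT_comp.
  - apply: filterS cvY => w cw _.
    have cG : ((J (n + m)%N w - J n w) ^+ 2)%:E @[m --> \oo]
        --> ((Y w - J n w) ^+ 2)%:E; last by rewrite /G (cvg_limn_einf_sup cG).1.
    apply: cvg_EFin; first exact: nearW.
    apply: (cvg_comp (fun m => J (n + m)%N w - J n w) (fun x : R => x ^+ 2));
      last exact: sqr_continuous.
    apply: cvgB; last exact: cvg_cst.
    exact: (cvg_comp (addn n) (J ^~ w) (@cvg_addnl n) cw).
apply: le_trans (fatou P measurableT mB _) _.
  by move=> m w _; rewrite lee_fin sqr_ge0.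
(* The lower limit is a limit of infima over tails, each at most the first term of its tail. *)
rewrite limn_einf_lim; apply: lime_le; first exact: is_cvg_einfs.
apply: nearW => k; apply: (@le_trans _ _
  (\int[P]_w ((J (n + k)%N w - J n w) ^+ 2)%:E)%E).
  by apply: ereal_inf_lbound; exists k => /=.
rewrite -EFin_Rintegral ?lee_fin; first exact/cauchyI/leq_addr.
by case: (sq_integrableB (sI (n + k)%N) (sI n)).
Qed.

End mean_square_limit.

Lemma cvge0_geometric (R : realType) (u : nat -> \bar R) (A theta : R) :
  0 <= theta < 1 -> (forall n, 0 <= u n <= ((A * theta ^+ n) ^+ 2)%:E)%E ->
  u @ \oo --> 0%E.
Proof.
move=> /andP[t0 t1] uA.
apply: (@squeeze_cvge _ _ _ _ (cst 0%E) _ (fun n => ((A * theta ^+ n) ^+ 2)%:E)).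
- exact: nearW.
- exact: cvg_cst.
- apply: cvg_EFin; first exact: nearW.
  have := @cvg_geometric R (A ^+ 2) (theta ^+ 2).
  rewrite ger0_norm ?sqr_ge0// expr_lt1// => /(_ t1).
  apply: cvg_trans; apply: near_eq_cvg; apply: nearW => n /=.
  by rewrite [RHS]exprMn -!exprM mulnC.
Qed.

(** * Dyadic Riemann sums of a Hölder continuous integrand *)

Section ito_existence.
Context {R : realType} {d : measure_display} {Omega : measurableType d}.
Variables (P : probability Omega R) (F : R -> set (set Omega)).
Variables (W : R -> Omega -> R) (T : R).
Hypotheses (hF : usual_conditions P F) (hW : is_wiener P F W) (T0 : 0 < T).
Local Notation kappa := (fine (@gauss_var R)).

(** The Itô isometry for deterministic coefficients: each new increment is orthogonal to the
    preceding sum. *)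
Lemma sq_sum_incr (t a : nat -> R) (k : nat) :
  (forall i, 0 <= t i) -> (forall i, t i < t i.+1) ->
  [/\ F_measurable F (t k) (fun w => \sum_(i < k) a i * incr W (t i) (t i.+1) w),
      sq_integrable P (fun w => \sum_(i < k) a i * incr W (t i) (t i.+1) w) &
      \int[P]_w ((\sum_(i < k) a i * incr W (t i) (t i.+1) w) ^+ 2)
      = kappa * \sum_(i < k) a i ^+ 2 * (t i.+1 - t i)].
Proof.
move=> t0 tlt; elim: k => [|k [FS sS ES]].
  have -> : (fun w => \sum_(i < 0) a i * incr W (t i) (t i.+1) w) = cst 0.
    by apply/funext => w; rewrite big_ord0.
  split; [exact: measurable_cst|exact: sq_integrable_cst|].
  under eq_Rintegral do rewrite big_ord0 expr0n.
  by rewrite Rintegral_cst// mul0r big_ord0 mulr0.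
set S := (fun w => \sum_(i < k) a i * incr W (t i) (t i.+1) w) in FS sS ES *.
have -> : (fun w => \sum_(i < k.+1) a i * incr W (t i) (t i.+1) w)
    = (fun w => S w + a k * incr W (t k) (t k.+1) w).
  by apply/funext => w; rewrite big_ord_recr.
have sD := sq_integrable_incr hF hW (t0 k) (tlt k).
have saD := sq_integrableZ (a k) sD.
split.
- apply: measurable_funD; first exact: (F_measurable_mono hF (t0 k) (ltW (tlt k))).
  apply: measurable_funM; first exact: measurable_cst.
  apply: measurable_funB; first exact: (F_measurable_wiener hF hW).
  exact: (F_measurable_wiener hF hW _ (ltW (tlt k))).
- exact: sq_integrableD.
have i1 : P.-integrable setT (EFin \o (fun w => S w ^+ 2)) by case: sS.
have i2 := integrableM_sq sS sD.
have i3 : P.-integrable setT (EFin \o (fun w => incr W (t k) (t k.+1) w ^+ 2)).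
  by case: sD.
transitivity (\int[P]_w (S w ^+ 2 + 2 * a k * (S w * incr W (t k) (t k.+1) w)
    + a k ^+ 2 * incr W (t k) (t k.+1) w ^+ 2)).
  by apply: eq_Rintegral => w _; rewrite big_ord_recr /= -/(S w); ring.
have i2' := integrableZR (2 * a k) i2; have i3' := integrableZR (a k ^+ 2) i3.
rewrite RintegralD//; last exact: integrableDR.
rewrite RintegralD// !RintegralZl// ES.
rewrite (Rintegral_mul_incr hF hW (t0 k) (tlt k) FS sS).
rewrite (Rintegral_incr_sqr hF hW (t0 k) (tlt k)) big_ord_recr /=; ring.
Qed.

Section covering.
Variable H : simple_process F T.

Lemma sp_time_cover (t : R) : 0 < t <= T ->
  exists2 i, (i < sp_size H)%N & sp_time H i < t <= sp_time H i.+1.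
Proof.
move=> /andP[t0 tT].
suff : forall k, (k <= sp_size H)%N -> t <= sp_time H k ->
    exists2 i, (i < sp_size H)%N & sp_time H i < t <= sp_time H i.+1.
  by apply; [exact: leqnn|rewrite sp_timeT].
elim=> [|k IH] kN tk; first by move: tk; rewrite sp_time0 leNgt t0.
have [tk'|tk'] := leP t (sp_time H k); first exact: IH (ltnW kN) tk'.
by exists k => //; rewrite tk' tk.
Qed.

(** The half-open intervals of the partition are disjoint, so exactly one indicator survives. *)
Lemma sp_val_eq (t : R) (w : Omega) (i : nat) : (i < sp_size H)%N ->
  sp_time H i < t <= sp_time H i.+1 -> sp_val H t w = sp_coef H i w.
Proof.
move=> iN /andP[it ti]; rewrite /sp_val (bigD1 (Ordinal iN))//= big1 => [|j ji].
  by rewrite addr0 indicE mem_set ?mulr1//= in_itv /= it ti.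
rewrite indicE memNset ?mulr0//= in_itv/= => /andP[jt tj].
have jN := ltn_ord j.
have : (j : nat) != i by apply: contra ji => /eqP ji; apply/eqP/val_inj.
rewrite neq_ltn => /orP[ji'|ij].
  have := @sp_time_le _ _ _ _ _ H j.+1 i; rewrite ji' ltnW// => /(_ isT) le1.
  by have := lt_le_trans it (le_trans tj le1); rewrite ltxx.
have := @sp_time_le _ _ _ _ _ H i.+1 j; rewrite ij ltnW// => /(_ isT) le1.
by have := lt_le_trans jt (le_trans ti le1); rewrite ltxx.
Qed.

End covering.

Variables (f : R -> R) (L M rho : R).
Hypotheses (mf : measurable_fun [set: R] f) (fM : forall t, `|f t| <= M).
Hypotheses (L0 : 0 <= L) (rho0 : 0 < rho).
Hypothesis hoelder_f : forall t z : R, 0 <= t <= T -> 0 <= z <= T ->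
  `|f t - f z| <= L * `|t - z| `^ rho.

Let tm (n i : nat) : R := T * i%:R / 2 ^+ n.

Let two_gt0 n : 0 < 2 ^+ n :> R. Proof. by rewrite exprn_gt0. Qed.

Let tm_lt n i : tm n i < tm n i.+1.
Proof. by rewrite /tm ltr_pM2r ?invr_gt0// ltr_pM2l// ltr_nat. Qed.

Let tm_ge0 n i : 0 <= tm n i.
Proof. by rewrite /tm !mulr_ge0// ?invr_ge0 ltW. Qed.

Let tm_le n i j : (i <= j)%N -> tm n i <= tm n j.
Proof. by move=> ij; rewrite /tm ler_pM2r ?invr_gt0// ler_pM2l// ler_nat. Qed.

Let tm_end n : tm n (2 ^ n) = T.
Proof. by rewrite /tm natrX mulfK// gt_eqF. Qed.

Let tm0 n : tm n 0 = 0. Proof. by rewrite /tm mulr0 mul0r. Qed.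

Let tm_mesh n i : tm n i.+1 - tm n i = T / 2 ^+ n.
Proof. by rewrite /tm -natr1; ring. Qed.

Let tm_refine n m i : (n <= m)%N -> tm m (i * 2 ^ (m - n)) = tm n i.
Proof.
move=> nm; rewrite /tm natrM natrX -{2}(subnK nm) exprD.
by field; rewrite !gt_eqF.
Qed.

(** The step process that freezes [f] at left endpoints of the grid. It is transparent, so that its
    fields reduce in later proofs. *)
Let dyadic (n : nat) : simple_process F T.
Proof.
refine (@SimpleProcess R d Omega F T (2 ^ n)%N (tm n) (fun i _ => f (tm n i))
  (tm0 n) (tm_end n) (fun i _ => tm_lt n i) _ _).
- by move=> i _; exact: measurable_cst.
- by exists M => *.
Defined.

(** The factor by which the Hölder bound shrinks when the mesh is halved. *)
Let theta : R := 2^-1 `^ rho.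

Let theta01 : 0 <= theta < 1.
Proof.
rewrite /theta powR_ge0/=.
have := @gt0_ltr_powR R rho rho0 2^-1 1; rewrite powR1; apply.
- by rewrite nnegrE.
- by rewrite nnegrE.
- by rewrite invf_lt1// ltr1n.
Qed.

Let modulus (n : nat) (t z : R) : 0 <= t <= T -> 0 <= z <= T ->
  `|t - z| <= T / 2 ^+ n -> `|f t - f z| <= L * T `^ rho * theta ^+ n.
Proof.
move=> tT zT tz; apply: le_trans (hoelder_f tT zT) _.
rewrite -mulrA ler_wpM2l//.
apply: (@le_trans _ _ ((T / 2 ^+ n) `^ rho)).
  by apply: ge0_ler_powR; rewrite ?nnegrE// ltW// divr_gt0.
have i2 : 0 <= (2 ^+ n)^-1 :> R by rewrite invr_ge0 ltW.
rewrite (powRM _ (ltW T0) i2) ler_wpM2l ?powR_ge0//.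
rewrite -exprVn -(@powR_mulrn _ (2^-1)) ?invr_ge0// -powRrM mulrC powRrM.
by rewrite powR_mulrn ?powR_ge0.
Qed.

(** Each coarse increment telescopes into fine ones. The index [j %/ 2 ^ (m - n)] is that of the
    coarse cell containing the [j]-th fine cell, so the sums of levels [n] and [m] can be subtracted
    termwise. *)
Let integral_dyadic_refine n m w : (n <= m)%N ->
  sp_integral W (dyadic n) w
  = \sum_(j < 2 ^ m) f (tm n (j %/ 2 ^ (m - n))) * incr W (tm m j) (tm m j.+1) w.
Proof.
move=> nm; rewrite /sp_integral /=.
rewrite -(big_mkord xpredT (fun i => f (tm n i) * (W (tm n i.+1) w - W (tm n i) w))).
rewrite -(big_mkord xpredT (fun j => f (tm n (j %/ 2 ^ (m - n))) * incr W (tm m j) (tm m j.+1) w)).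
have -> : (2 ^ m = 2 ^ n * 2 ^ (m - n))%N by rewrite -expnD subnKC.
rewrite big_nat_mul; apply: eq_bigr => i _.
rewrite -(tm_refine i.+1 nm) -(tm_refine i nm).
rewrite -(telescope_sumr (fun j => W (tm m j) w)) ?leq_mul2r ?leqnSn ?orbT//.
rewrite big_distrr/=; apply: eq_big_nat => j /andP[ij ji].
congr (f _ * _); rewrite tm_refine//; congr tm; apply/esym.
by apply/eqP; rewrite eqn_leq -ltnS ltn_divLR ?expn_gt0// ji leq_divRL ?expn_gt0// ij.
Qed.

(** By the isometry the distance is a weighted sum of the squares of [a j]. A fine node lies in the
    coarse cell whose left endpoint it is compared with, so [modulus] bounds each [a j]. *)
Let cauchy_dyadic n m : (n <= m)%N ->
  \int[P]_w ((sp_integral W (dyadic m) w - sp_integral W (dyadic n) w) ^+ 2)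
  <= (Num.sqrt (kappa * T) * (L * T `^ rho) * theta ^+ n) ^+ 2.
Proof.
move=> nm; have k0 : 0 <= kappa by rewrite fine_ge0// ltW// gauss_var_gt0.
pose a j := f (tm m j) - f (tm n (j %/ 2 ^ (m - n))).
have -> : (fun w => (sp_integral W (dyadic m) w - sp_integral W (dyadic n) w) ^+ 2)
    = fun w => (\sum_(j < 2 ^ m) a j * incr W (tm m j) (tm m j.+1) w) ^+ 2.
  apply/funext => w; rewrite (integral_dyadic_refine w nm) /sp_integral /= -sumrB.
  by congr (_ ^+ 2); apply: eq_bigr => j _; rewrite -mulrBl.
have [_ _ ->] := sq_sum_incr a (2 ^ m) (tm_ge0 m) (tm_lt m).
have -> : (Num.sqrt (kappa * T) * (L * T `^ rho) * theta ^+ n) ^+ 2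
    = kappa * (T * (L * T `^ rho * theta ^+ n) ^+ 2).
  rewrite -(mulrA (Num.sqrt _)) exprMn sqr_sqrtr ?mulrA//.
  by rewrite mulr_ge0// ltW.
rewrite ler_wpM2l//.
apply: (@le_trans _ _ (\sum_(j < 2 ^ m) (L * T `^ rho * theta ^+ n) ^+ 2 * (tm m j.+1 - tm m j))).
  apply: ler_sum => j _; rewrite ler_wpM2r ?subr_ge0 ?(ltW (tm_lt m j))//.
  rewrite -(real_normK (num_real (a j))) lerXn2r ?nnegrE//.
    by rewrite !mulr_ge0 ?powR_ge0 ?exprn_ge0//; case/andP: theta01.
  have jm : (j < 2 ^ m)%N := ltn_ord j.
  have b0 : (0 < 2 ^ (m - n))%N by rewrite expn_gt0.
  have e1 : tm n (j %/ 2 ^ (m - n)) <= tm m j.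
    by rewrite -(tm_refine _ nm); apply: tm_le; exact: leq_trunc_div.
  have e2 : tm m j <= tm n (j %/ 2 ^ (m - n)).+1.
    by rewrite -(tm_refine _ nm); apply: tm_le; rewrite ltnW// ltn_ceil.
  have e3 : tm m j <= T by rewrite -(tm_end m); apply: tm_le; exact: ltnW.
  apply: modulus; rewrite ?tm_ge0 ?e3//; first exact: le_trans e1 e3.
  by rewrite ger0_norm ?subr_ge0// -(tm_mesh n (j %/ 2 ^ (m - n))) lerB.
rewrite -mulr_sumr mulrC ler_wpM2r ?sqr_ge0//.
rewrite -(big_mkord xpredT (fun j => tm m j.+1 - tm m j)) telescope_sumr//.
by rewrite tm_end tm0 subr0.
Qed.

Lemma ito_exists : exists Y, is_ito_integral P F T W (fun t _ => f t) Y.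
Proof.
have [t0 t1] := andP theta01.
have sI n : sq_integrable P (sp_integral W (dyadic n)).
  by have [_ + _] := sp_partial_test hF hW (leqnn (sp_size (dyadic n))).
have K0 : 0 <= Num.sqrt (kappa * T) * (L * T `^ rho).
  by rewrite !mulr_ge0 ?sqrtr_ge0 ?powR_ge0.
have [Y [mY YI]] := mean_square_limit K0 theta01 sI cauchy_dyadic.
exists Y; split=> //; exists dyadic; split; last first.
  apply: (cvge0_geometric theta01) => n; apply/andP; split; last exact: YI.
  by apply: integral_ge0 => w _; rewrite lee_fin sqr_ge0.
apply: (@cvge0_geometric _ _ (Num.sqrt T * (L * T `^ rho)) _ theta01) => n.
apply/andP; split.
  apply: integral_ge0 => w _; apply: integral_ge0 => t _.
  by rewrite lee_fin sqr_ge0.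
set c := (X in (_ <= X)%E).
apply: (@le_trans _ _ (\int[P]_w (cst c w))%E); last first.
  by rewrite integral_cst//= probability_setT mule1.
apply: ge0_le_integralT => w.
  by apply: integral_ge0 => t _; rewrite lee_fin sqr_ge0.
have mD (D : set R) : measurable_fun D (fun t => ((f t - sp_val (dyadic n) t w) ^+ 2)%:E).
  apply/measurable_EFinP; apply: measurable_funX.
  by apply: measurable_funB; [exact: measurable_funTS|exact: measurable_sp_val].
(* The time 0 lies in no interval of the partition, so [sp_val] vanishes there whatever [f 0] is;
   this null point is discarded. *)
rewrite -integral_itv_obnd_cbnd//.
apply: (@le_trans _ _ (\int[lebesgue_measure]_(t in `]0%R, T])
   ((L * T `^ rho * theta ^+ n) ^+ 2)%:E)%E).
  apply: ge0_le_integral => //.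
  - by move=> t _; rewrite lee_fin sqr_ge0.
  - exact: mD.
  - move=> t /=; rewrite in_itv /= => /andP[t0' tT].
    rewrite lee_fin -(real_normK (num_real (f t - _))) lerXn2r ?nnegrE//.
      by rewrite !mulr_ge0 ?powR_ge0 ?exprn_ge0.
    have [|i iN it] := @sp_time_cover (dyadic n) t; first by rewrite t0' tT.
    rewrite (sp_val_eq w iN it) /=; move: it iN => /= /andP[it ti] iN.
    have e3 : tm n i <= T by rewrite -(tm_end n); apply: tm_le; exact: ltnW.
    apply: modulus; rewrite ?tm_ge0 ?e3 ?tT ?(ltW t0')//.
    by rewrite ger0_norm ?subr_ge0 ?(ltW it)// -(tm_mesh n i) lerB.
rewrite integral_cst//= lebesgue_measure_itv/= lte_fin T0 sube0 -EFinM lee_fin /c.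
by rewrite -[in leRHS]mulrA [leRHS]exprMn sqr_sqrtr ?(ltW T0)// mulrC.
Qed.

End ito_existence.

(** * Lower bound from a pair of indistinguishable integrands *)

Section norms.
Context {R : realType} {d : measure_display} {Omega : measurableType d}.
Variable P : probability Omega R.

Lemma Lnorm_cst_probability (p x : R) : 0 < p ->
  Lnorm P p%:E (fun=> x%:E) = (`|x|)%:E.
Proof.
move=> p0; rewrite unlock /Lnorm /=.
rewrite integral_cst//= probability_setT mule1 poweR_EFin -powRrM mulfV ?gt_eqF//.
by rewrite powRr1.
Qed.

Lemma integrable_Lnorm1 (Z : Omega -> R) : P.-integrable setT (EFin \o Z) ->
  ((`|\int[P]_w Z w|)%:E <= Lnorm P 1 (EFin \o Z))%E.
Proof.
move=> iZ; rewrite Lnorm1 EFin_normr_Rintegral//.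
by apply: le_abse_integral => //; case/integrableP : iZ.
Qed.

(* [r / (r - 1) <= 2], so [`|V| `^ (r / (r - 1)) <= 1 + V ^+ 2]. *)
Lemma Lnorm_conjugate_le (r : R) (V : Omega -> R) (v : R) : 2 <= r ->
  sq_integrable P V -> \int[P]_w (V w ^+ 2) = v ->
  (Lnorm P (r / (r - 1))%:E (EFin \o V) <= (1 + v)%:E)%E.
Proof.
move=> r2 sV <-; have [mV iV2] := sV.
set v2 := Rintegral _ _ _; set r' := r / (r - 1).
have r10 : 0 < r - 1 by lra.
have r'1 : 1 <= r' by rewrite /r' ler_pdivlMr//; lra.
have r'2 : r' <= 2 by rewrite /r' ler_pdivrMr//; lra.
have r'0 : 0 < r' by lra.
have v20 : 0 <= v2 by apply: Rintegral_ge0 => w _; exact: sqr_ge0.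
rewrite unlock /Lnorm.
have le1 : (\int[P]_w `|(EFin \o V) w| `^ r' <= (1 + v2)%:E)%E.
  rewrite /v2 EFinD EFin_Rintegral//.
  have -> : (1%:E = \int[P]_w cst (1%:E : \bar R) w)%E.
    by rewrite integral_cst//= probability_setT mule1.
  rewrite -ge0_integralD//; last 2 first.
  - by move=> w _; rewrite lee_fin sqr_ge0.
  - by apply/measurable_EFinP; exact: measurable_funX.
  apply: ge0_le_integralT => w /=; first by rewrite lee_fin powR_ge0.
  rewrite -EFinD lee_fin -(real_normK (num_real (V w))).
  have [V1|V1] := leP `|V w| 1.
    apply: (@le_trans _ _ 1); last by rewrite lerDl exprn_ge0.
    have <- : (1 : R) `^ r' = 1 by rewrite powR1.
    by apply: ge0_ler_powR; rewrite ?nnegrE// ltW.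
  rewrite -[`|V w| ^+ 2]powR_mulrn// ler_wpDl// ler_powR// ltW//.
apply: (@le_trans _ _ ((1 + v2)%:E `^ r'^-1)%E).
  apply: gt0_ler_poweR => //; first by rewrite invr_ge0 ltW.
  - by rewrite in_itv /= leey andbT; apply: integral_ge0 => w _; rewrite lee_fin powR_ge0.
  - by rewrite in_itv /= leey andbT lee_fin addr_ge0.
(* The base [1 + v2] is at least 1 and the exponent [r'^-1] at most 1, so the root does not exceed
   the base. *)
rewrite poweR_EFin lee_fin -[leRHS]powRr1 ?addr_ge0// ler_powR//.
  by rewrite lerDl.
by rewrite invf_le1.
Qed.

End norms.

Section deterministic_integrands.
Context {R : realType} {d : measure_display} {Omega : measurableType d}.
Variables (P : probability Omega R) (F : R -> set (set Omega)).
Variables (W : R -> Omega -> R) (T rho r q L s : R).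
Hypotheses (hF : usual_conditions P F) (hW : is_wiener P F W) (T0 : 0 < T).
Hypotheses (rho0 : 0 < rho) (r2 : 2 <= r) (rq : r < q) (L0 : 0 < L).
Local Notation kappa := (fine (@gauss_var R)).

Lemma deterministic_integrand (f : R -> R) : measurable_fun [set: R] f ->
  (forall t, `|f t| <= L) ->
  (forall t z, 0 <= t <= T -> 0 <= z <= T -> `|f t - f z| <= L * `|t - z| `^ rho) ->
  integrand_class P F T rho r q L (fun t _ => f t).
Proof.
move=> mf fL hf; have r0 : 0 < r by apply: lt_le_trans r2.
have q0 : 0 < q by exact: lt_trans rq.
split.
- move=> t _; apply: measurable_funTS.
  apply: (measurableT_comp mf); exact: measurable_fst.
- set S := ereal_sup _.
  have S0 : (0 <= S)%E.
    apply: (@le_trans _ _ (`|f 0|)%:E); first by rewrite lee_fin.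
    by apply: ereal_sup_ubound; exists 0 => //=; rewrite in_itv /= lexx ltW.
  have SL : (S <= L%:E)%E.
    by apply: ge_ereal_sup => _ [t _ <-]; rewrite lee_fin.
  have Sfin : S \is a fin_num by rewrite ge0_fin_numE// (le_lt_trans SL)// ltry.
  rewrite -(fineK Sfin) Lnorm_cst_probability// ger0_norm ?fine_ge0//.
  by rewrite fineK.
- by move=> t z tT zT; rewrite /rv_norm Lnorm_cst_probability// lee_fin hf.
Qed.

(** The zero disturbance is admissible at every level [delta2], so the adversary may leave the
    Wiener process intact. *)
Lemma exact_wiener (delta2 : R) : 0 <= s -> noisy_wieners T W s delta2 W.
Proof.
move=> s0; exists (cst 0); last by move=> t w _; rewrite /= mulr0 addr0.
exists (cst 0), (cst 0), (cst 0); split; last first.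
  move=> t y _; rewrite /= normr0 maxxx maxxx /abs_pow.
  by case: ifP => _; rewrite ?addr0 ?ler01// addr_ge0 ?powR_ge0.
split.
- by split; exact: cst_continuous.
- move=> t y _ /=; under eq_fun do rewrite subrr mul0r.
  exact: cvg_cst.
- by move=> t y _; exact: is_derive_cst.
- by move=> t y _; exact: is_derive_cst.
Qed.

(** Once a version exists, the choice made by [xget] satisfies the specification; the default value
    0 is ruled out. *)
Lemma ito_integralP (f : R -> R) : measurable_fun [set: R] f ->
  (forall t, `|f t| <= L) ->
  (forall t z, 0 <= t <= T -> 0 <= z <= T -> `|f t - f z| <= L * `|t - z| `^ rho) ->
  is_ito_integral P F T W (fun t _ => f t) (ito_integral P F T W (fun t _ => f t)).
Proof.
move=> mf fL hf; rewrite /ito_integral.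
have [Y hY] := ito_exists hF hW T0 mf fL (ltW L0) rho0 hf.
exact: (xgetPex (cst 0) (ex_intro _ Y hY)).
Qed.

Lemma measurable_run (A : algorithm T) (x : R -> R) (V : R -> Omega -> R) :
  (forall t, 0 <= t <= T -> measurable_fun setT (V t)) ->
  measurable_fun setT (run A (fun t _ => x t) V).
Proof.
move=> mV; rewrite (_ : run _ _ _ = phi A \o (fun w => cat_tuple
  [tuple x (ptsX A j) | j < nX A] [tuple V (ptsW A j) w | j < nW A])); last first.
  by [].
apply: (measurableT_comp (@phi_meas _ _ A)).
apply/measurable_fun_tnthP => i.
rewrite -[i]splitK; case: (fintype.split i) => j.
- rewrite (_ : _ \o _ = cst (x (ptsX A j))); first exact: measurable_cst.
  by apply/funext => w; exact: etrans (tnth_lshift _ _ _) (tnth_mktuple _ _).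
- rewrite (_ : _ \o _ = V (ptsW A j)); first exact/mV/ptsW_in.
  by apply/funext => w; exact: etrans (tnth_rshift _ _ _) (tnth_mktuple _ _).
Qed.

(** The difference of the two integrals has [L^r] norm at most twice the error, and its product with
    [V] has mean [2 * (kappa * I0)]. The denominator is the bound on the conjugate norm of [V],
    whose variance is [kappa * T]. *)
Lemma worst_case_ge (delta1 delta2 : R) (A : algorithm T) (f : R -> R)
    (p1 p2 : R * R -> R) : 0 <= s ->
  measurable_fun [set: R] f -> (forall t, `|f t| <= L) ->
  (forall t z, 0 <= t <= T -> 0 <= z <= T -> `|f t - f z| <= L * `|t - z| `^ rho) ->
  K1 T p1 -> K1 T p2 ->
  (forall j, f (ptsX A j) + delta1 * p1 (ptsX A j, f (ptsX A j))
     = - f (ptsX A j) + delta1 * p2 (ptsX A j, - f (ptsX A j))) ->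
  ((kappa * (\int[lebesgue_measure]_(t in `[0, T]) f t) / (1 + kappa * T))%:E
   <= worst_case_error P F W rho r q L s delta1 delta2 A)%E.
Proof.
move=> s0 mf fL hf K1p1 K1p2 agree.
pose f' t := - f t.
have mf' : measurable_fun [set: R] f' by exact: measurableT_comp.
have f'L t : `|f' t| <= L by rewrite normrN.
have hf' t z : 0 <= t <= T -> 0 <= z <= T -> `|f' t - f' z| <= L * `|t - z| `^ rho.
  by move=> tT zT; rewrite -opprD normrN; exact: hf.
pose Y1 := ito_integral P F T W (fun t _ => f t).
pose Y2 := ito_integral P F T W (fun t _ => f' t).
have [sY1 EY1] := ito_test hF hW T0 mf fL (ito_integralP mf fL hf).
have [sY2 EY2] := ito_test hF hW T0 mf' f'L (ito_integralP mf' f'L hf').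
pose X1 t (_ : Omega) := f t + delta1 * p1 (t, f t).
pose X2 t (_ : Omega) := f' t + delta1 * p2 (t, f' t).
pose g := run A X1 W.
have gE : g = run A X2 W.
  apply/funext => w; rewrite /g /run; congr (phi A (cat_tuple _ _)).
  by apply: eq_mktuple => j; rewrite /X1 /X2 agree.
have mg : measurable_fun setT g.
  by apply: measurable_run => t /andP[t0 _]; exact: (measurable_wiener hF hW).
set e := worst_case_error _ _ _ _ _ _ _ _ _ _ _.
have nW := exact_wiener delta2 s0.
have err (X X' : R -> Omega -> R) : integrand_class P F T rho r q L X ->
    noisy_integrands T X delta1 X' ->
    (rv_norm P r (fun w => ito_integral P F T W X w - run A X' W w)%R <= e)%E.
  move=> hX hX'; apply: (@le_trans _ _ (ereal_sup [set
      rv_norm P r (fun w => ito_integral P F T W X w - run A XW.1 XW.2 w)%R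
    | XW in noisy_integrands T X delta1 `*` noisy_wieners T W s delta2])).
    by apply: ereal_sup_ubound; exists (X', W).
  by apply: ereal_sup_ubound; exists X.
have e1 : (rv_norm P r (fun w => Y1 w - g w)%R <= e)%E.
  by apply: err; [exact: deterministic_integrand|exists p1].
have e2 : (rv_norm P r (fun w => Y2 w - g w)%R <= e)%E.
  by rewrite gE; apply: err; [exact: deterministic_integrand|exists p2].
rewrite -/Y1 in sY1 EY1; rewrite -/Y2 in sY2 EY2.
clear err nW gE; clearbody e Y1 Y2 g.
have [mY1 _] := sY1; have [mY2 _] := sY2.
pose V := incr W 0 T.
have sV : sq_integrable P V := sq_integrable_incr0 hF hW (ltW T0).
have k0 : 0 <= kappa by rewrite fine_ge0// ltW// gauss_var_gt0.
have kT : 0 < 1 + kappa * T by rewrite ltr_wpDr// mulr_ge0// ltW.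
have NV : (Lnorm P (r / (r - 1))%:E (EFin \o V) <= (1 + kappa * T)%:E)%E.
  by apply: Lnorm_conjugate_le => //;
    rewrite (Rintegral_incr_sqr hF hW (lexx 0) T0) subr0.
have r1 : 1 <= r by apply: le_trans r2; rewrite ler1n.
have r0 : 0 < r by exact: lt_le_trans ltr01 r1.
have r10 : 0 < r - 1 by rewrite subr_gt0 (lt_le_trans _ r2)// ltr1n.
have NY : (Lnorm P r%:E (EFin \o (fun w => Y1 w - Y2 w)%R) <= e + e)%E.
  have -> : (fun w => Y1 w - Y2 w) = ((fun w => Y1 w - g w) \+ (fun w => g w - Y2 w))%R.
    by apply/funext => w /=; ring.
  apply: le_trans (minkowski_EFin P (measurable_funB mY1 mg) (measurable_funB mg mY2) r1) _.
  apply: leeD; first exact: e1.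
  have -> : EFin \o (fun w => g w - Y2 w) = (\- (EFin \o (fun w => Y2 w - g w)%R))%E.
    by apply/funext => w /=; rewrite opprB.
  by rewrite oppe_Lnorm; exact: e2.
have sYV := integrableM_sq (sq_integrableB sY1 sY2) sV.
have := integrable_Lnorm1 sYV.
have -> : \int[P]_w ((Y1 w - Y2 w) * V w)
    = 2 * (kappa * \int[lebesgue_measure]_(t in `[0, T]) f t).
  under eq_Rintegral do rewrite mulrBl.
  rewrite RintegralB//; [|exact: integrableM_sq|exact: integrableM_sq].
  rewrite EY1 EY2.
  have -> : \int[lebesgue_measure]_(t in `[0, T]) f' t
      = - \int[lebesgue_measure]_(t in `[0, T]) f t.
    have i_f : lebesgue_measure.-integrable `[0, T] (EFin \o f).
      by apply: (integrable_bounded_itv (M := L)) => //; exact: measurable_funTS.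

    transitivity (\int[lebesgue_measure]_(t in `[0, T]) (-1 * f t)).
      by apply: eq_Rintegral => t _; rewrite mulN1r.

    by rewrite (RintegralZl _ _ i_f) ?mulN1r.
  ring.
set I0 := Rintegral _ _ _.
move=> h1.
have : ((2 * (kappa * I0))%:E <= (e + e) * (1 + kappa * T)%:E)%E.
  apply: (@le_trans _ _ (`|2 * (kappa * I0)|)%:E); first by rewrite lee_fin ler_norm.
  apply: le_trans h1 _.
  apply: le_trans (@hoelder _ _ _ P _ _ r (r / (r - 1)) _ _ _ _ _) _ => //.
  - exact: measurable_funB.
  - by case: sV.
  - exact: divr_gt0.
  - by field; rewrite !gt_eqF.
  by apply: lee_pmul => //; exact: Lnorm_ge0.
(* The error is an extended real: at [+oo] the claim is trivial, and at [-oo] the premise is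
   false. *)
case: e {e1 e2 NY h1} => [e||] //=.
- rewrite -EFinD -EFinM !lee_fin ler_pdivrMr//; lra.
- by rewrite leey.
- by rewrite addNye gt0_mulNye ?lte_fin.
Qed.

End deterministic_integrands.

(** * The two hard integrands *)

Lemma powR_dist (R : realType) (rho a b : R) : 0 < rho <= 1 -> 0 <= a -> 0 <= b ->
  `|a `^ rho - b `^ rho| <= `|a - b| `^ rho.
Proof.
move=> /andP[rho0 rho1]; wlog ab : a b / b <= a => [hw|] a0 b0.
  have [ba|ab] := leP b a; first exact: hw.
  by rewrite distrC (distrC a); apply: hw => //; exact: ltW.
have pow_ge (x : R) : 0 <= x <= 1 -> x <= x `^ rho.
  move=> /andP[]; rewrite le_eqVlt => /predU1P[<- _|x0 x1].
    by rewrite powR0// gt_eqF.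
  by apply: ger1_powR; rewrite ?x0.
have mono : b `^ rho <= a `^ rho by apply: ge0_ler_powR; rewrite ?nnegrE// ltW.
rewrite !ger0_norm ?subr_ge0//.
move: a0; rewrite le_eqVlt => /predU1P[a0|a0].
  have -> : b = 0 by apply/eqP; rewrite eq_le b0 a0 ab.
  by rewrite -a0 !subrr powR_ge0.
rewrite lerBlDr.
have e1 : b / a <= (b / a) `^ rho.
  by apply: pow_ge; rewrite divr_ge0 ?(ltW a0)// ler_pdivrMr// mul1r.
have e2 : (a - b) / a <= ((a - b) / a) `^ rho.
  apply: pow_ge; rewrite divr_ge0 ?(ltW a0) ?subr_ge0// ler_pdivrMr// mul1r.
  by rewrite lerBlDr lerDl.
have ab0 : 0 <= a - b by rewrite subr_ge0.
have E (x : R) : 0 <= x -> x `^ rho = (x / a) `^ rho * a `^ rho.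
  by move=> x0; rewrite -powRM ?divr_ge0 ?(ltW a0)// divfK// gt_eqF.
rewrite (E b b0) (E (a - b) ab0) -mulrDl -[leLHS]mul1r ler_wpM2r ?powR_ge0//.
apply: le_trans (lerD e2 e1).
by rewrite -mulrDl subrK divff// gt_eqF.
Qed.

Section distance_to_nodes.
Context {R : realType}.
Variables (T : R) (m : nat) (pts : 'I_m -> R).
Hypothesis T0 : 0 < T.

(** The initial value [T] of the iterated minimum caps the distance, so that it is bounded at all
    real times, including those outside [[0, T]]. *)
Definition node_dist (t : R) : R := \big[Num.min/T]_(j < m) `|t - pts j|.

Lemma node_dist_ge (t h : R) : h <= T -> (forall j, h <= `|t - pts j|) ->
  h <= node_dist t.
Proof.
move=> hT hj; rewrite /node_dist; apply: (big_ind (fun x => h <= x)) => // x y hx hy.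
by rewrite le_min hx.
Qed.

Lemma node_dist_ge0 (t : R) : 0 <= node_dist t.
Proof. by apply: node_dist_ge => //; exact: ltW. Qed.

Lemma node_dist_leT (t : R) : node_dist t <= T.
Proof.
rewrite /node_dist; elim/big_rec: _ => // j x _ xT.
by rewrite ge_min xT orbT.
Qed.

Lemma node_dist_node (j : 'I_m) : node_dist (pts j) = 0.
Proof.
apply/eqP; rewrite eq_le node_dist_ge0 andbT.
by apply: (bigmin_inf j) => //; rewrite subrr normr0.
Qed.

Lemma node_dist_lip (t z : R) : `|node_dist t - node_dist z| <= `|t - z|.
Proof.
rewrite /node_dist; apply: (big_ind2 (fun x y => `|x - y| <= `|t - z|)).
- by rewrite subrr normr0.
- move=> x1 x2 y1 y2; rewrite !ler_norml => /andP[a1 a2] /andP[b1 b2].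
  by rewrite /Num.min; case: ltP => c1; case: ltP => c2; apply/andP; split; lra.
- move=> j _; apply: le_trans (ler_dist_dist _ _) _.
  by rewrite opprB addrA subrK.
Qed.

Lemma measurable_node_dist : measurable_fun [set: R] node_dist.
Proof.
rewrite /node_dist; elim: (index_enum _) => [|j s IH].
  by under eq_fun do rewrite big_nil; exact: measurable_cst.
under eq_fun do rewrite big_cons.
apply: measurable_minr => //; apply: measurableT_comp => //.
exact: measurable_funB.
Qed.

(** The intervals of radius [T / (4 * m%:R)] around the [m] nodes have total length at most [T / 2].
    On the rest of [[0, T]], of measure at least [T / 2], the function is at least [h]. *)
Lemma integral_node_dist (g : R -> R) (h : R) : measurable_fun [set: R] g ->
  (exists M, forall t, `|g t| <= M) -> (forall t, 0 <= g t) -> 0 <= h -> (0 < m)%N ->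
  (forall t, T / (4 * m%:R) <= node_dist t -> h <= g t) ->
  h * (T / 2) <= \int[lebesgue_measure]_(t in `[0, T]) g t.
Proof.
move=> mg [M gM] g0 h0 m0 hg.
have m0' : 0 < m%:R :> R by rewrite ltr0n.
pose e := T / (4 * m%:R).
have e0 : 0 < e by rewrite divr_gt0// mulr_gt0.
pose B (j : 'I_m) : set R := `[pts j - e, pts j + e]%classic.
have mB j : measurable (B j) by exact: measurable_itv.
have i1 (j : 'I_m) : lebesgue_measure.-integrable `[0, T] (EFin \o (\1_(B j) : R -> R)).
  apply: (integrable_bounded_itv (M := 1)) => //.
  by move=> t; rewrite indicE; case: (_ \in _); rewrite ?normr1 ?normr0.
have [|iS ES] := @Rintegral_sum _ _ R lebesgue_measure `[0, T]%classic m
  (fun j => \1_(B j) : R -> R) _ i1; first exact: measurable_itv.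
have ic : lebesgue_measure.-integrable `[0, T] (EFin \o cst h).
  by apply: (integrable_bounded_itv (M := `|h|)).
have iSh : lebesgue_measure.-integrable `[0, T]
    (EFin \o (fun t => h * \sum_(j < m) \1_(B j) t)).
  exact: (integrableZl _ h iS).
have ig : lebesgue_measure.-integrable `[0, T] (EFin \o g).
  by apply: (integrable_bounded_itv (M := M)) => //; exact: measurable_funTS.
(* This minorant of [g] equals [h] away from the intervals and is at most 0 on them, even where they
   overlap. *)
apply: (@le_trans _ _ (\int[lebesgue_measure]_(t in `[0, T])
    (h - h * \sum_(j < m) \1_(B j) t))).
  rewrite RintegralB// RintegralZl// ES Rintegral_cst//=.
  rewrite lebesgue_measure_itv/= lte_fin T0 sube0 /= -mulrBr ler_wpM2l//.
  have Bj (j : 'I_m) : \int[lebesgue_measure]_(t in `[0, T]) \1_(B j) t <= 2 * e.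
    have le1 : (lebesgue_measure (B j `&` `[0%R, T]) <= (2 * e)%:E)%E.
      apply: (@le_trans _ _ (lebesgue_measure (B j))).
        apply: le_measure; last exact: subIsetl.
          by apply/mem_set; apply: measurableI => //; exact: measurable_itv.
        by apply/mem_set; exact: mB.
      rewrite lebesgue_measure_itv/= lte_fin; case: ifP => _.
        by rewrite -EFinD lee_fin; lra.
      by rewrite lee_fin mulr_ge0// ltW.
    rewrite /Rintegral integral_indic//; last exact: mB.
    rewrite -lee_fin fineK//.
    by rewrite ge0_fin_numE// (le_lt_trans le1)// ltry.
  have : \sum_(j < m) \int[lebesgue_measure]_(t in `[0, T]) \1_(B j) t <= T / 2.
    apply: le_trans (ler_sum _ (fun j _ => Bj j)) _.
    rewrite sumr_const card_ord -[_ *+ m]mulr_natr /e.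
    by rewrite [leLHS](_ : _ = T / 2)//; field; rewrite gt_eqF.
  have half : T - T / 2 = T / 2 by field.
  by move=> sT; rewrite -[leLHS]half lerB.
apply: le_Rintegral => //.
- exact: (integrableB _ ic iSh).
- move=> t _; have [[j /set_mem Bj]|nB] := pselect (exists j, t \in B j).
    apply: le_trans (g0 t); rewrite subr_le0 ler_peMr//.
    rewrite (bigD1 j)//= indicE mem_set// lerDl sumr_ge0//.
  rewrite big1 ?mulr0 ?subr0.
    apply: hg; apply: node_dist_ge.
      rewrite ler_pdivrMr ?mulr_gt0// ler_peMr ?(ltW T0)//.
      by rewrite (@le_trans _ _ 4) ?ler1n// ler_peMr// ler1n.
    move=> j; rewrite leNgt; apply/negP => tj; apply: nB; exists j.
    rewrite inE /B /= in_itv /=; move: tj; rewrite ltr_norml => /andP[].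
    rewrite -/e; lra.
  move=> j _; rewrite indicE; case: (boolP (_ \in _)) => // tB.
  by case: nB; exists j.
Qed.

End distance_to_nodes.

Section lower_bounds.
Context {R : realType} {d : measure_display} {Omega : measurableType d}.
Variables (P : probability Omega R) (F : R -> set (set Omega)).
Variables (W : R -> Omega -> R) (T rho r q L s : R).
Hypotheses (hF : usual_conditions P F) (hW : is_wiener P F W) (T0 : 0 < T).
Hypotheses (rho01 : 0 < rho <= 1) (r2 : 2 <= r) (rq : r < q) (L0 : 0 < L).
Hypothesis s0 : 0 <= s.
Local Notation kappa := (fine (@gauss_var R)).
Variables (delta1 delta2 : R) (A : algorithm T).

Let rho0 : 0 < rho. Proof. by case/andP: rho01. Qed.

(** With disturbances [-1] and [1], the noisy versions of the constants [delta1] and [- delta1] are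
    both identically 0. The condition [delta1 <= L] keeps these constants in the class. *)
Lemma worst_case_ge_delta1 : 0 <= delta1 <= L ->
  ((kappa * (delta1 * T) / (1 + kappa * T))%:E
   <= worst_case_error P F W rho r q L s delta1 delta2 A)%E.
Proof.
move=> /andP[d0 dL].
have := @worst_case_ge R d Omega P F W T rho r q L s hF hW T0 rho0 r2 rq L0
  delta1 delta2 A (cst delta1) (cst (-1)) (cst 1) s0.
rewrite Rintegral_cst//= lebesgue_measure_itv/= lte_fin T0 sube0 /=; apply.
- exact: measurable_cst.
- by move=> t; rewrite ger0_norm.
- by move=> t z _ _; rewrite subrr normr0 mulr_ge0 ?powR_ge0// ltW.
- by split=> [|t y _]; [exact: measurable_cst|rewrite /= normrN1 lerDl].
- by split=> [|t y _]; [exact: measurable_cst|rewrite /= normr1 lerDl].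
- by move=> j; rewrite mulrN1 mulr1 subrr addNr.
Qed.

Lemma worst_case_ge_rate (n : nat) : Phi T n A ->
  ((kappa * (L / (1 + T `^ rho) * (T / 4) `^ rho * n%:R `^ (- rho) * (T / 2))
      / (1 + kappa * T))%:E
   <= worst_case_error P F W rho r q L s delta1 delta2 A)%E.
Proof.
move=> An; pose m := nX A.
have m0 : (0 < m)%N := nX_gt0 A.
have mn : (m <= n)%N := leq_trans (leq_addr _ _) An.
have m0' : 0 < m%:R :> R by rewrite ltr0n.
have n0' : 0 < n%:R :> R by rewrite ltr0n (leq_trans m0).
have Tr0 : 0 <= T `^ rho by exact: powR_ge0.
have Tr1 : 0 < 1 + T `^ rho by rewrite ltr_wpDr.
pose K := L / (1 + T `^ rho).
have K0 : 0 <= K by rewrite divr_ge0 ?(ltW L0) ?(ltW Tr1).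
have KL : K <= L.
  by rewrite /K ler_pdivrMr// ler_peMr ?(ltW L0)// lerDl.
pose D := node_dist T (ptsX A).
pose f t := K * D t `^ rho.
have f0 t : 0 <= f t by rewrite mulr_ge0 ?powR_ge0.
have mf : measurable_fun [set: R] f.
  apply: measurable_funM; first exact: measurable_cst.
  apply: (measurableT_comp (measurable_powR rho)).
  exact: measurable_node_dist.
have fL t : `|f t| <= L.
  rewrite ger0_norm// /f.
  apply: (@le_trans _ _ (K * T `^ rho)).
    rewrite ler_wpM2l//; apply: ge0_ler_powR; rewrite ?nnegrE ?node_dist_ge0
      ?(ltW T0) ?(ltW rho0)//.
    exact: node_dist_leT.
  rewrite /K mulrAC ler_pdivrMr// ler_wpM2l ?(ltW L0)// lerDr//.
have hf t z : 0 <= t <= T -> 0 <= z <= T -> `|f t - f z| <= L * `|t - z| `^ rho.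
  move=> _ _; rewrite /f -mulrBr normrM (ger0_norm K0).
  apply: ler_pM => //.
  apply: (le_trans (powR_dist rho01 (node_dist_ge0 _ T0 t) (node_dist_ge0 _ T0 z))).
  by apply: ge0_ler_powR; rewrite ?nnegrE ?(ltW rho0)// node_dist_lip.
have If : K * (T / 4) `^ rho * n%:R `^ (- rho) * (T / 2)
    <= \int[lebesgue_measure]_(t in `[0, T]) f t.
  apply: (@integral_node_dist R T m (ptsX A) T0) => //; first by exists L.
    by apply: mulr_ge0; rewrite ?powR_ge0//; apply: mulr_ge0; rewrite ?powR_ge0.
  move=> t Dt; rewrite /f -mulrA ler_wpM2l//.
  rewrite powRN -[X in _ * X]powR_inv1 ?powR_ge0// powRAC powR_inv1 ?(ltW n0')//.
  rewrite -powRM ?invr_ge0 ?divr_ge0 ?(ltW T0) ?(ltW n0')//.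
  apply: ge0_ler_powR; rewrite ?nnegrE ?(ltW rho0)//.
  - by rewrite mulr_ge0 ?invr_ge0 ?divr_ge0 ?(ltW T0) ?(ltW n0').
  - exact: node_dist_ge0.
  (* The number [m] of nodes is at most [n], so [T / (4 * n%:R)] is at most the radius
     [T / (4 * m%:R)]. *)
  apply: le_trans Dt; rewrite -mulrA -invfM ler_wpM2l ?(ltW T0)//.
  by rewrite lef_pV2 ?posrE ?mulr_gt0// ler_wpM2l// ler_nat.
have k0 : 0 < kappa.
  by rewrite fine_gt0// gauss_var_gt0 gauss_var_lty.
have := @worst_case_ge R d Omega P F W T rho r q L s hF hW T0 rho0 r2 rq L0
  delta1 delta2 A f (cst 0) (cst 0) s0 mf fL hf.
have K10 : K1 T (cst 0 : R * R -> R).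
  by split=> [|t y _]; [exact: measurable_cst|rewrite /= normr0 addr_ge0].
move=> /(_ K10 K10) h; apply: le_trans (h _); last first.
  (* At every node both [f] and [- f] vanish, so even exact data cannot tell them apart. *)
  by move=> j; rewrite /f /D node_dist_node// powR0 ?gt_eqF// mulr0 oppr0.
rewrite lee_fin ler_wpM2r ?invr_ge0 ?ler_wpM2l ?(ltW k0)//.
by rewrite addr_ge0// mulr_ge0 ?(ltW k0) ?(ltW T0).
Qed.

End lower_bounds.

(** The case [L = 0] is excluded because all integrals then vanish almost surely and the zero
    algorithm is exact. The constants are quantified before the probability space, hence do not
    depend on it. *)
Theorem lemma1 (R : realType) (rho r q s L T : R)
    (hrho : 0 < rho <= 1) (hr : 2 <= r) (hq : r < q) (hs : 0 <= s)
    (hL : 0 < L) (hT : 0 < T) :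
  exists (c delta0 : R) (n0 : nat),
    [/\ 0 < c, 0 < delta0, (0 < n0)%N &
      forall (d : measure_display) (Omega : measurableType d)
        (P : probability Omega R) (F : R -> set (set Omega))
        (W : R -> Omega -> R),
        usual_conditions P F -> is_wiener P F W ->
      forall (n : nat) (delta1 delta2 : R), (n0 <= n)%N ->
        0 <= delta1 <= delta0 -> 0 <= delta2 <= delta0 ->
        ((c * Num.max (n%:R `^ (- rho)) delta1)%:E
          <= minimal_error P F W T rho r q L s delta1 delta2 n)%E].
Proof.
pose kappa := fine (@gauss_var R).
have k0 : 0 < kappa by rewrite fine_gt0// gauss_var_gt0 gauss_var_lty.
have kT : 0 < kappa / (1 + kappa * T).
  by rewrite divr_gt0// addr_gt0// mulr_gt0.
pose a := L / (1 + T `^ rho) * (T / 4) `^ rho * (T / 2).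
have a0 : 0 < a.
  have Tr1 : 0 < 1 + T `^ rho by rewrite ltr_wpDr// powR_ge0.
  by rewrite !mulr_gt0 ?invr_gt0 ?powR_gt0// divr_gt0.
(* The minimum of [T] and [a] serves both branches of the maximum. The threshold [L] is the range of
   [delta1] allowed by [worst_case_ge_delta1]. At [n = 1] there is no algorithm, and the infimum is
   [+oo]. *)
exists (kappa / (1 + kappa * T) * Num.min T a), L, 1%N; split => //.
  by rewrite mulr_gt0// lt_min hT.
move=> d Omega P F W hF hW n delta1 delta2 n1 d1 _.
apply: le_ereal_inf_tmp => _ [A An <-].
have [d10 _] := andP d1.
have n0 : 0 <= n%:R `^ (- rho) by exact: powR_ge0.
rewrite /Num.max; case: ifP => _.
- apply: le_trans (worst_case_ge_delta1 hF hW hT hrho hr hq hL hs delta2 A d1).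
  rewrite lee_fin -/kappa [leRHS](_ : _ = kappa / (1 + kappa * T) * T * delta1);
    last by ring.
  by rewrite ler_wpM2r// ler_wpM2l ?(ltW kT)// ge_min lexx.
- apply: le_trans (worst_case_ge_rate hF hW hT hrho hr hq hL hs delta1 delta2 An).
  rewrite lee_fin -/kappa [leRHS](_ : _
    = kappa / (1 + kappa * T) * a * n%:R `^ (- rho)); last by rewrite /a; ring.
  by rewrite ler_wpM2r// ler_wpM2l ?(ltW kT)// ge_min lexx orbT.
Qed.
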